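(* Fix $\rho>0$, the jump density $p$ (with $\mathbb{E}[Y_1]<\infty$), and $x>0$, and let $\lambda\to\infty$. (i) If $\delta>0$, then $\sup_{D\in\mathcal{D}}\mathbb{E}_x\left[\int_0^{\tau}e^{-\delta t}dD_t\right]\sim\frac{\lambda\mathbb{E}[Y_1]}{\delta}$. (ii) If $\delta>0$ and $T>0$, then $\sup_{D\in\mathcal{D}}\mathbb{E}_x\left[\int_0^{T\wedge\tau}e^{-\delta t}dD_t\right]\sim\frac{\lambda\mathbb{E}[Y_1]}{\delta}(1-e^{-\delta T})$. (iii) If $\delta=0$ and $T>0$, then $\sup_{D\in\mathcal{D}}\mathbb{E}_x\left[\int_0^{T\wedge\tau}dD_t\right]\sim\lambda\mathbb{E}[Y_1]T$. Here $f\sim g$ means $f/g\to 1$ as $\lambda\to\infty$.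
   Context: Dual risk model: $\rho>0$, $\lambda>0$; $N_t$ is a Poisson process with intensity $\lambda$ and $J_t=\sum_{i=1}^{N_t}Y_i$, where $Y_i$ are i.i.d. positive random variables with common density $p(y)$, $y>0$, independent of $N$. Given a dividend strategy $D$, the surplus is $X_t=x-\rho t-D_t+J_t$, $X_0=x>0$. $\mathcal{D}$ is the set of admissible dividend strategies: all adapted nondecreasing càdlàg processes $D$ ($D_t$ is the cumulative dividend paid up to time $t$). The ruin time is $\tau=\inf\{t>0:X_t\le 0\}$. $\mathbb{E}_x$ denotes expectation with $X_0=x$.
   Formalization: The integrals are taken over [0, T∧τ), so a lump sum paid at 0 counts but one paid at T∧τ does not; if a payment at τ counted, an arbitrarily large ruinous dividend would make the supremum infinite for the unconstrained class of strategies. *)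

(* Defs.v *)
From HB Require Import structures.
From mathcomp Require Import all_boot all_order all_algebra.
From mathcomp Require Import all_classical all_reals all_analysis.
From mathcomp Require Import measurable_realfun.
Set Implicit Arguments. Unset Strict Implicit. Unset Printing Implicit Defensive.
Import Order.TTheory GRing.Theory Num.Theory.
Import numFieldNormedType.Exports.
Local Open Scope classical_set_scope.
Local Open Scope ring_scope.

(*  - E n : the (n+1)-th inter-arrival time of the Poisson process N   *)
(*  - Y n : the (n+1)-th jump size Y_{n+1}                             *)
(* N_t = #{n >= 1 : E_1 + ... + E_n <= t},  J_t = sum_{i <= N_t} Y_i. *)
Section dual_risk.
Context {R : realType} {d : measure_display} {Omega : measurableType d}.
Variable P : probability Omega R.

Definition mutually_independent {I : eqType} (X : I -> Omega -> R) : Prop :=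
  (forall i, measurable_fun setT (X i)) /\
  forall (s : seq I), uniq s -> forall B : I -> set R,
    (forall i, measurable (B i)) ->
    P (\bigcap_(i in [set` s]) (X i @^-1` B i)) =
    (\prod_(i <- s) P (X i @^-1` B i))%E.

Definition is_exponential (lam : R) (Z : Omega -> R) : Prop :=
  forall t : R, P [set w | Z w <= t] =
    (if t < 0 then 0 else 1 - expR (- (lam * t)))%:E.

Definition has_density (p : R -> R) (Z : Omega -> R) : Prop :=
  forall B : set R, measurable B ->
    P (Z @^-1` B) =
    (\int[lebesgue_measure]_(y in B `&` [set y : R | (0 < y)%R]) (p y)%:E)%E.

Definition compound_poisson_model (lam : R) (p : R -> R)
    (E Y : nat -> Omega -> R) : Prop :=
  [/\ mutually_independent
        (fun i : bool * nat => if i.1 then E i.2 else Y i.2),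
      forall n, is_exponential lam (E n) &
      forall n, has_density p (Y n)].

(* n-th arrival time (of the (n+1)-th jump) S_{n+1} = E_1+...+E_{n+1} *)
Definition arrival (E : nat -> Omega -> R) (n : nat) (w : Omega) : R :=
  \sum_(i < n.+1) E i w.

(* J_t = sum_{i=1}^{N_t} Y_i  (extended-real valued) *)
Definition jump_process (E Y : nat -> Omega -> R) (t : R) (w : Omega)
  : \bar R :=
  (\sum_(i <oo | (arrival E i w <= t)%R) (Y i w)%:E)%E.

Definition nat_filtration (E Y : nat -> Omega -> R) (t : R)
  : set (set Omega) :=
  <<s [set A | exists s : R, exists B : set (\bar R),
         [/\ 0 <= s, s <= t, measurable B & A = jump_process E Y s @^-1` B]] >>.

(* A dividend strategy: for every w, t |-> D w t is the cumulative     *)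
(* dividend paid up to time t, a nondecreasing right-continuous (hence *)
(* cadlag) function; D w t = 0 for t < 0 (i.e. D_{0-} = 0).            *)
Definition admissible (E Y : nat -> Omega -> R)
    (D : Omega -> cumulative R R) : Prop :=
  (forall w t, t < 0 -> D w t = 0) /\
  (forall t, 0 <= t -> forall B : set R, measurable B ->
     nat_filtration E Y t ((fun w => D w t) @^-1` B)).

Definition surplus (x rho : R) (E Y : nat -> Omega -> R)
    (D : Omega -> cumulative R R) (t : R) (w : Omega) : \bar R :=
  ((x - rho * t - D w t)%R%:E + jump_process E Y t w)%E.

Definition ruin_time (x rho : R) (E Y : nat -> Omega -> R)
    (D : Omega -> cumulative R R) (w : Omega) : \bar R :=
  ereal_inf [set t%:E | t in [set t : R | 0 < t /\
                                (surplus x rho E Y D t w <= 0)%E]].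

(* E_x [ int_{[0, T /\ tau)} e^{-delta t} dD_t ]  (T may be +oo);      *)
(* the Stieltjes integral is w.r.t. the Lebesgue-Stieltjes measure of  *)
(* t |-> D w t, so a lump sum at time 0 (D_0 - D_{0-}) is counted.     *)
Definition discounted_dividends (x rho delta : R) (T : \bar R)
    (E Y : nat -> Omega -> R) (D : Omega -> cumulative R R) : \bar R :=
  (\int[P]_w
     (\int[lebesgue_stieltjes_measure (D w)]_(t in
          [set t : R | (0 <= t)%R /\
             (t%:E < Order.min T (ruin_time x rho E Y D w))%E])
        (expR (- (delta * t)))%R%:E))%E.

Definition value_function (x rho delta : R) (T : \bar R)
    (E Y : nat -> Omega -> R) : \bar R :=
  ereal_sup [set discounted_dividends x rho delta T E Y D
            | D in [set D | admissible E Y D]].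

End dual_risk.

(* Main.v *)
(** Before ruin the dividends paid up to time [t] are at most [x + J_t].  Since
    [expR (- delta * t)] is dominated by a step function on a grid of mesh [h],
    the discounted dividends are at most a weighted sum of the values [x + J_s]
    at grid points, and [E J_s <= E Y_1 * (lam * s + O (sqrt lam))].
    Conversely, retain the first [rho * T] of revenue and pay out all later
    revenue at the points of a finite grid: if [J_eps >= rho * T] for some
    [eps < x / rho] there is no ruin before [T], and this event has probability
    tending to 1.

    Only factorized expectations are used.  Replacing indicators of arrival
    times by Chernoff weights [expR (theta * (s - S_i))] with
    [|theta| = sqrt lam], the mean number of arrivals before [s] is bounded from
    both sides by geometric sums; the bad event of the lower bound is likewise
    dominated by products of exponentials of the [E_j] and of the [Y_j]. *)

Require Import Defs.
From HB Require Import structures.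
From mathcomp Require Import all_boot all_order all_algebra.
From mathcomp Require Import all_classical all_reals all_analysis.
From mathcomp Require Import measurable_realfun.
From mathcomp Require Import ring lra.
Set Implicit Arguments.
Unset Strict Implicit.
Import Order.TTheory GRing.Theory Num.Theory.
Import numFieldNormedType.Exports.
Local Open Scope classical_set_scope.
Local Open Scope ring_scope.

(** * Integrals of nonmeasurable functions and equality in law *)

(** Measurability is the obstacle behind the first lemmas. [p] is only a nonnegative function of
    integral 1, and for a general strategy the discounted dividends depend on the path through a
    ruin time whose measurability is never established. Integrals are therefore compared as suprema
    over simple functions, with measurability required on one side only. Signs of jumps and waiting
    times hold only almost surely, hence the truncations by [Num.max] and the almost sure
    comparisons. The exponent [sqrt lam] balances two errors: it moves the index where the geometric
    regime starts by about [s * sqrt lam], and it leaves a geometric sum of size at most [sqrt lam].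
    Both are negligible against [lam]. The amount [rho * T] is the whole running cost up to the
    horizon, so once it is retained the capital [x] is never touched; before time [eps] the capital
    alone pays the cost. The number [k] of jumps needed to collect it must not depend on [lam]; this
    is possible because the law of a jump depends on [p] alone. The infinite horizon is reached from
    below through a large finite [T]. *)

Section lower_integral.
Context {d} {T : measurableType d} {R : realType}.
Variable mu : {measure set T -> \bar R}.
Local Open Scope ereal_scope.
Import HBNNSimple.

(* The library integral of a nonnegative function is a supremum over simple
   functions below it, so monotonicity needs no measurability. *)
Lemma le_lower_integral (D : set T) (f1 f2 : T -> \bar R) :
  (forall x, D x -> 0 <= f1 x) -> (forall x, D x -> f1 x <= f2 x) ->
  \int[mu]_(x in D) f1 x <= \int[mu]_(x in D) f2 x.
Proof.
move=> f10 f12; have f20 x : D x -> 0 <= f2 x.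
  by move=> Dx; exact: le_trans (f10 x Dx) (f12 x Dx).
rewrite !ge0_integralE//; apply: ereal_sup_le => _ [h hf1 <-].
exists h => // x; apply: (le_trans (hf1 x)).
by rewrite !patchE; case: ifPn => // /set_mem; exact: f12.
Qed.

(** The supremum defining the integral is approached along a sequence of simple functions. Their
    pointwise supremum is measurable, stays below [f], and has an integral at least as large as
    every term. *)
Lemma lower_integral_attained (D : set T) (f : T -> \bar R) :
  measurable D -> (forall x, D x -> 0 <= f x) ->
  exists g : T -> \bar R, [/\ measurable_fun setT g, forall x, 0 <= g x,
    forall x, D x -> g x <= f x &
    \int[mu]_(x in D) g x = \int[mu]_(x in D) f x].
Proof.
move=> mD f0; rewrite (ge0_integralE _ f0).
set S := [set _ | _ in _].
have /set0P S0 : S !=set0.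
  exists (sintegral mu nnsfun0), nnsfun0 => //= x.
  by rewrite patchE; case: ifPn => // /set_mem; exact: f0.
have [u Su cu] : exists2 u : (\bar R)^nat, (forall n, S (u n)) & u @ \oo --> ereal_sup S.
  have [u Su cu] := ereal_sup_seq S0.
  by exists u => // n; exact: Su.
have /choice[h hP] : forall n, exists h : {nnsfun T >-> R},
    (forall x, (h x)%:E <= (f \_ D) x) /\ sintegral mu h = u n.
  by move=> n; have [h hf <-] := Su n; exists h.
pose g x := ereal_sup (range (fun n => (h n x)%:E)).
have hg n x : (h n x)%:E <= g x by apply: ereal_sup_ubound; exists n.
have gf x : g x <= (f \_ D) x by apply: ge_ereal_sup => _ [n _ <-]; exact: (hP n).1.
have g0 x : 0 <= g x by apply: le_trans (hg 0%N x); rewrite lee_fin.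
have gfD x : D x -> g x <= f x.
  by move=> Dx; apply: le_trans (gf x) _; rewrite patchE mem_set.
have gD x : ~ D x -> g x = 0.
  by move=> Dx; apply/eqP; rewrite eq_le g0 andbT; have := gf x; rewrite patchE memNset.
exists g; split => //.
  have -> : g = fun x => esups (fun n => (h n x)%:E) 0%N.
    by apply/funext => x; congr ereal_sup; apply/seteqP; split => _ [n _ <-]; exists n.
  by apply: measurable_fun_esups => n; exact/measurable_EFinP.
apply/eqP; rewrite eq_le; apply/andP; split.
  rewrite -(ge0_integralE _ f0); exact: le_lower_integral.
apply: ge_ereal_sup => y Sy.
rewrite (@le_trans _ _ (ereal_sup S))//; first exact: ereal_sup_ubound.
rewrite -(cvg_lim _ cu)//; apply: lime_le; first by apply/cvg_ex; exists (ereal_sup S).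
apply: nearW => n; have [_ <-] := hP n.
rewrite -integralT_nnsfun integral_mkcond [leRHS]integral_mkcond.
apply: le_lower_integral => x _.
  by rewrite patch_setT lee_fin.
rewrite patch_setT patchE; case: ifPn => [_|/negP Dx]; first exact: hg.
have := hg n x; rewrite gD// => Dx'; apply: Dx; exact: mem_set.
Qed.

End lower_integral.

Section transfer.
Local Open Scope ereal_scope.
Import HBNNSimple.

Let transfer_half {d} {T : measurableType d} {R : realType}
    (mu : {measure set T -> \bar R}) (k : T -> \bar R)
    (X : T -> R) (f : {nnsfun R >-> R}) :
  measurable_fun setT k -> (forall x, 0 <= k x) -> measurable_fun setT X ->
  \int[mu]_x (k x * (f (X x))%:E) =
  \sum_(r \in range f) r%:E * \int[mu]_x (k x * (\1_(f @^-1` [set r]) (X x))%:E).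
Proof.
move=> mk k0 mX.
under eq_integral => x _.
  rewrite fimfunE -fsumEFin // ge0_mule_fsumr; last first.
    by move=> y; exact: nnfun_muleindic_ge0.
  over.
have m1 y : measurable_fun setT (fun x => (\1_(f @^-1` [set y]) (X x))%:E : \bar R).
  apply/measurable_EFinP; apply: measurableT_comp mX.
  by apply: measurable_indic; exact: measurable_sfunP.
rewrite ge0_integral_fsum//=; last 2 first.
- move=> y; apply: emeasurable_funM => //.
  under eq_fun do rewrite EFinM.
  exact: measurable_funeM.
- move=> y x _; rewrite mule_ge0//; exact: nnfun_muleindic_ge0.
apply: eq_fsbigr => y /set_mem [z _ yE].
rewrite -ge0_integralZl//.
- by apply: eq_integral => x _; rewrite EFinM muleCA.
- by apply: emeasurable_funM.
- by move=> x _; rewrite mule_ge0// lee_fin.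
- by rewrite lee_fin -yE.
Qed.

(* Two weighted laws that agree on events have the same integrals; this one
   principle yields both change of density and factorization of expectations. *)
Lemma ge0_integral_transfer {d1 d2} {T1 : measurableType d1} {T2 : measurableType d2}
    {R : realType} (m1 : {measure set T1 -> \bar R}) (m2 : {measure set T2 -> \bar R})
    (k1 : T1 -> \bar R) (k2 : T2 -> \bar R) (X1 : T1 -> R) (X2 : T2 -> R)
    (f : R -> \bar R) :
  measurable_fun setT k1 -> (forall x, 0 <= k1 x) -> measurable_fun setT X1 ->
  measurable_fun setT k2 -> (forall x, 0 <= k2 x) -> measurable_fun setT X2 ->
  (forall B, measurable B ->
    \int[m1]_x (k1 x * (\1_B (X1 x))%:E) = \int[m2]_x (k2 x * (\1_B (X2 x))%:E)) ->
  measurable_fun setT f -> (forall y, 0 <= f y) ->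
  \int[m1]_x (k1 x * f (X1 x)) = \int[m2]_x (k2 x * f (X2 x)).
Proof.
move=> mk1 k10 mX1 mk2 k20 mX2 H mf f0.
pose f_ := nnsfun_approx measurableT mf.
have fcv y : (f_ n y)%:E @[n --> \oo] --> f y by exact: cvg_nnsfun_approx.
have fnd y m n : (m <= n)%N -> (f_ m y <= f_ n y)%R.
  by move=> mn; exact/lefP/nd_nnsfun_approx.
have lim_ d (T : measurableType d) (m : {measure set T -> \bar R})
    (k : T -> \bar R) (X : T -> R) :
  measurable_fun setT k -> (forall x, 0 <= k x) -> measurable_fun setT X ->
  \int[m]_x (k x * f (X x)) = limn (fun n => \int[m]_x (k x * (f_ n (X x))%:E)).
  move=> mk k0 mX; rewrite -monotone_convergence//.
  - apply: eq_integral => x _; apply/esym/cvg_lim => //.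
    rewrite muleC; under eq_fun do rewrite muleC.
    have [kx|] := boolP (k x \is a fin_num); first exact: cvgeZr.
    (* Multiplication by an infinite weight is not continuous. If [f (X x) = 0], every approximation
       vanishes as well and [0 * +oo = 0]; otherwise the approximations are eventually positive and
       the products eventually [+oo]. *)
    rewrite ge0_fin_numE// -leNgt leye_eq => /eqP ->.
    have [fX0|fX0] := eqVneq (f (X x)) 0.
      rewrite fX0 mul0e; apply: cvg_near_cst; apply: nearW => n.
      suff -> : f_ n (X x) = 0%R by rewrite mul0e.
      have : (f_ n (X x))%:E <= f (X x).
        by rewrite /f_ nnsfun_approxE; exact: le_approx.
      by rewrite fX0 lee_fin => fX; apply/eqP; rewrite eq_le fX fun_ge0.
    have fX : 0 < f (X x) by rewrite lt_neqAle eq_sym fX0 f0.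
    rewrite gt0_muley//; apply: cvg_near_cst.
    have [N fN] : exists N, (0 < f_ N (X x))%R.
      apply: contrapT => /forallNP fN; move: fX0; apply/negP/negPn/eqP.
      rewrite -(cvg_lim _ (fcv (X x)))//; apply: lim_near_cst => //.
      apply: nearW => n; congr EFin; apply/eqP; rewrite eq_le fun_ge0 andbT leNgt.
      exact/negP/fN.
    by exists N => // n /= Nn; rewrite gt0_muley// lte_fin (lt_le_trans fN)// fnd.
  - move=> n; apply: emeasurable_funM => //.
    apply/measurable_EFinP; exact: measurableT_comp.
  - by move=> n x _; rewrite mule_ge0// lee_fin.
  - by move=> x _ m' n mn; rewrite lee_wpmul2l// lee_fin fnd.
rewrite !lim_//; congr (limn _); apply/funext => n.
rewrite !transfer_half//; apply: eq_fsbigr => r _; rewrite H//.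
Qed.

End transfer.

(** * Jump laws given by a possibly nonmeasurable density *)

Section density.
Context {R : realType}.
Variable p : R -> R.
Local Notation mu := lebesgue_measure.
Local Notation pos := [set y : R | (0 < y)%R].
Hypothesis p0 : forall y, 0 < y -> 0 <= p y.
Hypothesis p1 : (\int[mu]_(y in pos) (p y)%:E = 1)%E.
Local Open Scope ereal_scope.

Lemma measurable_pos : measurable pos.
Proof. by rewrite (_ : pos = `]0%R, +oo[%classic) //; apply/seteqP; split => x /=; rewrite in_itv/= andbT. Qed.
Let mpos := measurable_pos.

(* [p] itself need not be measurable; its integrals are those of a measurable
   minorant of full mass. *)
Lemma density_minorant : exists g : R -> \bar R,
  [/\ measurable_fun setT g, forall y, 0 <= g y, forall y, (0 < y)%R -> g y <= (p y)%:E,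
    \int[mu]_(y in pos) g y = 1 &
    \int[mu]_(y in pos) (y%:E * g y) = \int[mu]_(y in pos) (y * p y)%:E].
Proof.
have [y Dy|g [mg g0 gp g1]] := @lower_integral_attained _ _ _ mu pos (EFin \o p) mpos.
  by rewrite lee_fin p0.
rewrite p1 in g1.
exists g; split => //.
apply/eqP; rewrite eq_le; apply/andP; split.
  apply: le_lower_integral => y y0; first by rewrite mule_ge0// lee_fin ltW.
  by rewrite EFinM lee_wpmul2l ?gp// lee_fin ltW.
have [y Dy|k [mk k0 kp <-]] := @lower_integral_attained _ _ _ mu pos (fun y => (y * p y)%:E) mpos.
  by rewrite lee_fin mulr_ge0 ?p0// ltW.
(* [k'] is the minorant of [p] that attains the mean. The maximum of [g] and [k'] is still below
   [p], so its mass cannot exceed that of [g]; hence [k' <= g] almost everywhere and [g] carries the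
   full mean too. *)
pose k' y := (y^-1)%:E * k y.
have mk' : measurable_fun pos k'.
  apply: emeasurable_funM; last exact: measurable_funTS.
  apply/measurable_EFinP; apply: open_continuous_measurable_fun.
    exact: open_gt.
  by move=> y; rewrite inE/= => y0; apply: inv_continuous; exact: lt0r_neq0.
have maxg y : (0 < y)%R -> maxe (g y) (k' y) <= (p y)%:E.
  move=> y0; rewrite ge_max gp//= /k' -(@lee_pmul2l _ y%:E)// ?lte_fin//.
  by rewrite muleA -EFinM divff ?gt_eqF// mul1e -EFinM kp.
have gk0 y : 0 <= maxe (g y) (k' y) by rewrite le_max g0.
have gfy y : (0 < y)%R -> g y \is a fin_num.
  by move=> y0; rewrite ge0_fin_numE// (le_lt_trans (gp _ y0))// ltry.
have gfin : mu.-integrable pos g.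
  apply/integrableP; split; first exact: measurable_funTS.
  by under eq_integral => y _ do rewrite gee0_abs//; rewrite g1 ltry.
have mmax : measurable_fun pos (fun y => maxe (g y) (k' y)).
  by apply: measurable_maxe => //; exact: measurable_funTS.
have gmax : \int[mu]_(y in pos) (maxe (g y) (k' y) - g y) = 0.
  rewrite integralB//; last first.
    apply/integrableP; split => //.
    under eq_integral => y _ do rewrite gee0_abs//.
    apply: (@le_lt_trans _ _ 1); last exact: ltry.
    by rewrite -p1; apply: le_lower_integral.
  apply/eqP; rewrite g1 eq_le; apply/andP; split.
    by rewrite leeBlDr// add0e -p1; exact: le_lower_integral.
  rewrite leeBrDr// add0e -g1; apply: ge0_le_integral => //.
    exact: measurable_funTS.
  by move=> y _; rewrite le_max lexx.
have : ae_eq mu pos (fun y => maxe (g y) (k' y) - g y) (cst 0).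
  apply/ae_eq_integral_abs => //.
    by apply: emeasurable_funB => //; exact: measurable_funTS.
  rewrite -[RHS]gmax; apply: eq_integral => y /set_mem y0; rewrite gee0_abs//.
  by rewrite sube_ge0 ?le_max ?lexx// gfy.
move=> aeq.
apply: ae_ge0_le_integral => //.
- exact: measurable_funTS.
- by move=> y y0; rewrite mule_ge0// lee_fin ltW.
- by apply: emeasurable_funM; exact: measurable_funTS.
apply: filterS aeq => y H y0; have {H} := H y0.
move=> /eqP; rewrite sube_eq ?fin_num_adde_defl ?gfy// ?add0e => [/eqP gk|]; last first.
  by rewrite ge0_fin_numE// (le_lt_trans (maxg _ y0))// ltry.
have : k' y <= g y by rewrite -[leRHS]gk le_max lexx orbT.
rewrite /k' -(@lee_pmul2l _ y%:E)// ?lte_fin//.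
by rewrite muleA -EFinM divff ?gt_eqF// mul1e.
Qed.

Context {d : measure_display} {Omega : measurableType d} (P : probability Omega R).
Variable Z : Omega -> R.
Hypothesis mZ : measurable_fun setT Z.
Hypothesis pZ : has_density P p Z.
Variable g : R -> \bar R.
Hypothesis mg : measurable_fun setT g.
Hypothesis g0 : forall y, 0 <= g y.
Hypothesis gp : forall y, (0 < y)%R -> g y <= (p y)%:E.
Hypothesis g1 : \int[mu]_(y in pos) g y = 1.

Let mZB B : measurable B -> measurable (Z @^-1` B).
Proof. by move=> mB; rewrite -[X in measurable X]setTI; exact: mZ. Qed.

(** One inequality holds on every measurable set because [g] is below [p]. Applied to a set and to
    its complement, with total mass 1 on both sides, it forces equality. *)
Lemma law_minorant B : measurable B ->
  P (Z @^-1` B) = \int[mu]_(y in B `&` pos) g y.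
Proof.
move=> mB.
have ge C : measurable C -> \int[mu]_(y in C `&` pos) g y <= P (Z @^-1` C).
  by move=> mC; rewrite pZ//; apply: le_lower_integral => y [_ y0]//; exact: gp.
apply/eqP; rewrite eq_le ge// andbT.
have PC : P (Z @^-1` B) = 1 - P (Z @^-1` (~` B)).
  by rewrite -{1}[Z @^-1` B]setCK preimage_setC probability_setC//; exact/mZB/measurableC.
have fC : P (Z @^-1` (~` B)) \is a fin_num.
  by apply: fin_num_measure; exact/mZB/measurableC.
rewrite PC leeBlDr//.
rewrite -[leLHS]g1 (_ : pos = (B `&` pos) `|` (~` B `&` pos)); last first.
  by rewrite -setIUl setUv setTI.
rewrite ge0_integral_setU//.
- rewrite -setIUl setUv setTI leeD2l//.
  by apply: ge; exact: measurableC.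
- exact: measurableI.
- by apply: measurableI => //; exact: measurableC.
- exact: measurable_funTS.
- by apply/disj_setPS => y [[By _] [nBy _]].
Qed.

Lemma expectation_density (f : R -> \bar R) : measurable_fun setT f ->
  (forall y, 0 <= f y) -> \int[P]_w f (Z w) = \int[mu]_(y in pos) (g y * f y).
Proof.
move=> mf f0.
have mgp : measurable_fun setT (g \_ pos).
  by apply/(measurable_restrictT _ _).1 => //; exact: measurable_funTS.
have := @ge0_integral_transfer _ _ _ _ _ P mu (cst 1) (g \_ pos) Z id f.
move=> /(_ (measurable_cst _) (fun=> lee01) mZ mgp _ (@measurable_id _ _ _) _ mf f0).
have -> : \int[mu]_y ((g \_ pos) y * f (id y)) = \int[mu]_(y in pos) (g y * f y).
  rewrite [RHS]integral_mkcond; apply: eq_integral => y _.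
  by rewrite !patchE; case: ifPn; rewrite ?mul0e.
move=> <-.
- by apply: eq_integral => w _; rewrite mul1e.
- by move=> y; rewrite erestrict_ge0.
move=> B mB.
transitivity (\int[P]_w (\1_(Z @^-1` B) w)%:E).
  by apply: eq_integral => w _; rewrite mul1e.
rewrite integral_indic//; last exact: mZB.
rewrite setIT.
transitivity (\int[mu]_(y in B `&` pos) g y); first exact: law_minorant.
rewrite [LHS]integral_mkcond; apply: eq_integral => y _.
rewrite !patchE in_setI indicE /=.
by case: (y \in B); case: (y \in pos) => /=; rewrite ?mule1 ?mule0 ?mul0e.
Qed.

End density.

(** * Exponential laws and independence *)

Section exponential_law.
Context {R : realType} {d : measure_display} {Omega : measurableType d}.
Variables (P : probability Omega R) (lam : R) (Z : Omega -> R).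
Hypothesis lam0 : 0 < lam.
Hypothesis mZ : measurable_fun setT Z.
Hypothesis eZ : is_exponential P lam Z.
Local Open Scope ereal_scope.

Let mZB B : measurable B -> measurable (Z @^-1` B).
Proof. by move=> mB; rewrite -[X in measurable X]setTI; exact: mZ. Qed.

Let exponential_prob_le0 (t : R) : (t <= 0)%R -> exponential_prob lam `]-oo, t] = 0.
Proof.
move=> t0; rewrite /exponential_prob -integral_itv_bndo_bndc; last first.
  apply/measurable_funTS/measurable_EFinP; exact: measurable_exponential_pdf.
apply: integral0_eq => y /=; rewrite in_itv/= => yt.
by rewrite lt0_exponential_pdf// (lt_le_trans yt).
Qed.

Let exponential_prob_cdf (t : R) :
  exponential_prob lam `]-oo, t] = P [set w | (Z w <= t)%R].
Proof.
rewrite eZ; have [t0|t0] := leP t 0%R.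
  rewrite exponential_prob_le0//; case: ltP => // t0'.
  by rewrite (_ : t = 0%R) ?mulr0 ?oppr0 ?expR0 ?subrr//; apply/eqP; rewrite eq_le t0.
rewrite ltNge (ltW t0)/= EFinB -mulNr -exponential_prob_itv0c// /exponential_prob.
have -> : `]-oo, t]%classic = `]-oo, 0%R[%classic `|` `[0%R, t]%classic.
  apply/seteqP; split => y /=; rewrite !in_itv/=.
    by move=> yt; have [y0|y0] := ltP y 0%R; [left|right].
  by case=> [y0|/andP[]//]; rewrite ltW// (lt_trans y0).
rewrite ge0_integral_setU//=.
- rewrite integral0_eq ?add0e// => y /=; rewrite in_itv/= => y0.
  by rewrite lt0_exponential_pdf.
- apply/measurable_funTS/measurable_EFinP; exact: measurable_exponential_pdf.
- by move=> y _; rewrite lee_fin exponential_pdf_ge0// ltW.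
- by apply/disj_setPS => y [/=]; rewrite !in_itv/= => y0 /andP[]; rewrite leNgt y0.
Qed.

(** The distribution function fixes the values on half-open intervals, which are stable under
    intersection and generate the Borel sets, so uniqueness of measures applies. *)
Lemma exponential_law B : measurable B -> P (Z @^-1` B) = exponential_prob lam B.
Proof.
move=> mB.
pose m2 := exponential_distribution_exponential_prob__canonical__measure_function_Measure lam0.
pose m1 := @measure_function_pushforward__canonical__measure_function_Measure _ _ _ (measurableTypeR R) R P Z.
rewrite -[RHS]/(m2 B) -[LHS]/(m1 mZ B).
have mu_unique := @measure_unique _ R (measurableTypeR R) (@ocitv R)
  (fun n => `](- n%:R)%R, n%:R]%classic) erefl (@ocitvI R) _ _ (m1 mZ) m2.
apply: mu_unique => //.
- by move=> n; exact: is_ocitv.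
- rewrite -subTset => y _; exists (Num.truncn `|y|).+1 => //=.
  have := truncnS_gt `|y|; rewrite in_itv/= => yn.
  have := ler_norm y; have := ler_norm (- y); rewrite normrN; lra.
- move=> _ [[a b] _ <-]/=.
  have [ab|ba] := ltP a b; last by rewrite set_itv_ge ?measure0// bnd_simp -leNgt.
  have -> : `]a, b]%classic = `]-oo, b] `\` `]-oo, a].
    apply/seteqP; split => y /=; rewrite !in_itv/=.
      by move=> /andP[? ->]; split => //; apply/negP; rewrite -ltNge.
    by move=> [-> /negP]; rewrite -ltNge => ->.
  have sub : `]-oo, b]%classic `&` `]-oo, a]%classic = `]-oo, a]%classic.
    by rewrite setIC; apply/setIidl => y /=; rewrite !in_itv/= => /le_trans; apply; exact: ltW.
  rewrite [RHS]measureD//; last by rewrite -ge0_fin_numE// fin_num_measure.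
  rewrite measureD//; last first.
    by rewrite -ge0_fin_numE// fin_num_measure//; exact: mZB.
  by rewrite sub /m2/= !exponential_prob_cdf.
- move=> n; rewrite (@le_lt_trans _ _ 1) ?ltry//.
  by apply: probability_le1; exact: mZB.
Qed.

Lemma exponential_ge0 : P [set w | (Z w < 0)%R] = 0.
Proof.
have -> : [set w | (Z w < 0)%R] = Z @^-1` `]-oo, 0%R[.
  by apply/seteqP; split => w /=; rewrite in_itv.
rewrite exponential_law//; apply: integral0_eq => y /=; rewrite in_itv/=.
by move=> y0; rewrite lt0_exponential_pdf.
Qed.

Lemma exponential_mgf (th : R) : (th < lam)%R ->
  \int[P]_w (expR (th * Z w))%:E = (lam / (lam - th))%:E.
Proof.
move=> thl.
have mth : measurable_fun setT (fun y : R => (expR (th * y))%:E).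
  apply/measurable_EFinP; apply: measurableT_comp => //.
have mpdf (r : R) : measurable_fun setT (fun y : R => (exponential_pdf r y)%:E).
  by apply/measurable_EFinP; exact: measurable_exponential_pdf.
have pdf0 (r y : R) : (0 <= r)%R -> 0 <= (exponential_pdf r y)%:E.
  by move=> r0; rewrite lee_fin exponential_pdf_ge0.
have l0 := ltW lam0.
have := @ge0_integral_transfer _ _ _ _ _ P lebesgue_measure (cst 1) _ Z id _
  (measurable_cst _) (fun=> lee01) mZ (mpdf lam) (fun y => pdf0 _ y l0)
  (@measurable_id _ _ _) _ mth (fun y => expR_ge0 _).
under eq_integral do rewrite mul1e.
move=> ->; last first.
  move=> B mB.
  transitivity (\int[P]_w (\1_(Z @^-1` B) w)%:E).
    by apply: eq_integral => w _; rewrite mul1e.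
  rewrite integral_indic//; last exact: mZB.
  rewrite setIT.
  transitivity (exponential_prob lam B); first exact: exponential_law.
  rewrite /exponential_prob [LHS]integral_mkcond; apply: eq_integral => y _.
  by rewrite !patchE indicE /=; case: ifP => _; rewrite ?mule1 ?mule0.
(* Exponential tilting: [expR (th * y)] times the density of rate [lam] is [lam / (lam - th)] times
   the density of rate [lam - th], whose mass is 1. *)
transitivity (\int[lebesgue_measure]_y
    ((lam / (lam - th))%:E * (exponential_pdf (lam - th) y)%:E)).
  apply: eq_integral => y _; rewrite -!EFinM; congr EFin.
  have [y0|y0] := ltP y 0%R; first by rewrite !lt0_exponential_pdf// mul0r mulr0.
  rewrite !exponential_pdfE// -mulrA -expRD mulrA divfK ?subr_eq0 ?gt_eqF//.
  by congr (_ * expR _)%R; ring.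
rewrite ge0_integralZl//.
- by rewrite integral_exponential_pdf ?subr_gt0// mule1.
- exact: mpdf.
- by move=> y _; apply: pdf0; rewrite subr_ge0 ltW.
- by rewrite lee_fin divr_ge0// subr_ge0 ltW.
Qed.

End exponential_law.

(** * Factorization of expectations under independence *)

Section independence.
Context {R : realType} {d : measure_display} {Omega : measurableType d}.
Variables (P : probability Omega R) (I : eqType) (X : I -> Omega -> R).
Hypothesis indX : mutually_independent P X.
Local Open Scope ereal_scope.

Let mX i : measurable_fun setT (X i). Proof. exact: indX.1. Qed.

Lemma expectation_prod_indep (f : I -> R -> R) (s : seq I) :
  (forall i, measurable_fun setT (f i)) -> (forall i y, (0 <= f i y)%R) -> uniq s ->
  \int[P]_w (\prod_(i <- s) f i (X i w))%:E =
  \prod_(i <- s) \int[P]_w (f i (X i w))%:E.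
Proof.
move=> mf f0 us.
(* The product mixes functions on [s1] with indicators on [s2]. With [s1] empty it is the definition
   of independence; each induction step upgrades one indicator to a function by transfer of laws. *)
suff H s1 : forall s2 (B : I -> set R), (forall i, measurable (B i)) -> uniq (s1 ++ s2) ->
  \int[P]_w (\prod_(i <- s1) f i (X i w) * \prod_(i <- s2) \1_(B i) (X i w))%:E =
  \prod_(i <- s1) \int[P]_w (f i (X i w))%:E * \prod_(i <- s2) P (X i @^-1` B i).
  have := H s [::] (fun=> set0) (fun=> measurable0); rewrite cats0 => /(_ us).
  by rewrite big_nil mule1 => <-; apply: eq_integral => w _; rewrite big_nil mulr1.
elim: s1 => [|i s1 IH] s2 B mB.
  move=> /= us2; rewrite big_nil mul1e -indX.2//.
  rewrite -[X in P X]setIT -(integral_indic P measurableT); last first.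
    by apply: fin_bigcap_measurable => // i _; rewrite -[X in measurable X]setTI; exact: mX.
  apply: eq_integral => w _; rewrite big_nil mul1r; congr EFin.
  elim: s2 {us2} => [|j s2 IH]; first by rewrite big_nil set_nil bigcap_set0 indicT.
  rewrite big_cons IH !indicE -natrM mulnb; congr (_%:R); congr nat_of_bool.
  apply/andP/idP => [[/set_mem/= Bj /set_mem/= Bs]|/set_mem/= Bs].
    apply/mem_set => k /=; rewrite in_cons => /predU1P[->//|]; exact: Bs.
  split; apply/mem_set; first by apply: Bs; rewrite /= mem_head.
  by move=> k /= ks; apply: Bs; rewrite /= in_cons ks orbT.
move=> /= /andP[is12 us12].
have mBX C j : measurable C -> measurable_fun setT (fun w => \1_C (X j w) : R).
  by move=> mC; apply: measurableT_comp (mX j); exact: measurable_indic.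
have mk1 : measurable_fun setT
    (fun w => (\prod_(j <- s1) f j (X j w) * \prod_(j <- s2) \1_(B j) (X j w))%:E).
  apply/measurable_EFinP/measurable_funM; apply: measurable_prod => j _.
    exact: measurableT_comp.
  exact: mBX.
have k10 w : 0 <= (\prod_(j <- s1) f j (X j w) * \prod_(j <- s2) \1_(B j) (X j w))%:E.
  by rewrite lee_fin mulr_ge0// prodr_ge0// => j _.
set c := \prod_(j <- s1) \int[P]_w (f j (X j w))%:E * \prod_(j <- s2) P (X j @^-1` B j).
have c0 : 0 <= c.
  rewrite mule_ge0 ?prode_ge0//.
  by move=> j _; apply: integral_ge0 => w _; rewrite lee_fin.
have mfi : measurable_fun setT (EFin \o f i) by exact/measurable_EFinP.
have fi0 y : 0 <= (EFin \o f i) y by rewrite lee_fin.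
have mfiX : measurable_fun setT (fun w => (f i (X i w))%:E).
  by apply/measurable_EFinP; exact: measurableT_comp.
have := @ge0_integral_transfer _ _ _ _ _ P P _ (cst c) (X i) (X i) _
  mk1 k10 (mX i) (measurable_cst _) (fun=> c0) (mX i) _ mfi fi0.
rewrite ge0_integralZl//.
move=> H'; rewrite big_cons -muleA -/c [RHS]muleC -[RHS]H'.
  apply: eq_integral => w _; rewrite big_cons -EFinM; congr EFin; ring.
(* Since [i] lies outside [s1 ++ s2], the set [C] can be placed at [i] without disturbing the other
   factors; the equality of weighted laws is then the induction hypothesis for [i :: s2]. *)
move=> C mC; pose B' j := if j == i then C else B j.
have mB' j : measurable (B' j) by rewrite /B'; case: ifP.
have us' : uniq (s1 ++ i :: s2).
  by rewrite (perm_uniq (_ : perm_eq _ (i :: s1 ++ s2))) /= ?is12// (perm_catCA s1 [:: i]).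
have nis j : j \in s2 -> (j == i) = false.
  by move=> js; apply/negbTE; apply: contraNneq is12 => <-; rewrite mem_cat js orbT.
have := IH (i :: s2) B' mB' us'; have B'i : B' i = C by rewrite /B' eqxx.
have PB' : \prod_(j <- s2) P (X j @^-1` B' j) = \prod_(j <- s2) P (X j @^-1` B j).
  by apply: eq_big_seq => j /nis; rewrite /B' => ->.
rewrite [in RHS]big_cons B'i PB'.
rewrite muleCA -/c => {}IH.
have mC1 : measurable_fun setT (fun w => (\1_C (X i w))%:E : \bar R).
  exact/measurable_EFinP/mBX.
rewrite ge0_integralZl//.
rewrite (_ : \int[P]_w (\1_C (X i w))%:E = P (X i @^-1` C)); last first.
  rewrite -[X in P X]setIT -(integral_indic P measurableT) //.
  by rewrite -[X in measurable X]setTI; exact: mX.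
rewrite muleC -IH; apply: eq_integral => w _.
rewrite big_cons B'i -EFinM; congr EFin.
have -> : (\prod_(j <- s2) \1_(B' j) (X j w) = \prod_(j <- s2) \1_(B j) (X j w) :> R)%R.
  by apply: eq_big_seq => j /nis; rewrite /B' => ->.
ring.
Qed.

End independence.

Lemma expectation_gt0 {R : realType} {d : measure_display} {Omega : measurableType d}
    (P : probability Omega R) (f : Omega -> \bar R) :
  measurable_fun setT f -> (forall w, 0 <= f w)%E ->
  {ae P, forall w, (0 < f w)%E} -> (0 < \int[P]_w f w)%E.
Proof.
move=> mf f0 fpos; rewrite lt_neqAle integral_ge0// andbT; apply/eqP => /esym If0.
have fz : ae_eq P setT f (cst 0%E).
  apply/ae_eq_integral_abs => //.
  by rewrite -[RHS]If0; apply: eq_integral => w _; rewrite gee0_abs.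
have [N [mN PN sub]] : {ae P, forall w : Omega, False}.
  by apply: filterS2 fz fpos => w /(_ I) ->; rewrite ltxx.
have : P setT = 0%E by rewrite -PN; congr (P _); apply/seteqP; split => // w _; exact: sub.
by rewrite probability_setT => /eqP; rewrite onee_eq0.
Qed.

(** * Exponential moments of jumps and arrival times *)

Section moments.
Context {R : realType} {d : measure_display} {Omega : measurableType d}.
Variables (P : probability Omega R) (lam : R) (p : R -> R) (E Y : nat -> Omega -> R).
Hypothesis lam0 : 0 < lam.
Hypothesis p0 : forall y, 0 < y -> 0 <= p y.
Local Notation mu := lebesgue_measure.
Local Notation pos := [set y : R | (0 < y)%R].
Hypothesis p1 : (\int[mu]_(y in pos) (p y)%:E = 1)%E.
Hypothesis model : compound_poisson_model P lam p E Y.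
Local Open Scope ereal_scope.

Definition mean_jump : \bar R := \int[mu]_(y in pos) (y * p y)%:E.

Definition laplace_jump : \bar R := \int[P]_w (expR (- Y 0%N w))%:E.

Lemma measurable_E n : measurable_fun setT (E n).
Proof. by case: model => -[mX _] _ _; exact: (mX (true, n)). Qed.

Lemma measurable_Y n : measurable_fun setT (Y n).
Proof. by case: model => -[mX _] _ _; exact: (mX (false, n)). Qed.

Lemma measurable_arrival n : measurable_fun setT (arrival E n).
Proof. by apply: measurable_sum => i; exact: measurable_E. Qed.

Lemma ae_E_ge0 n : {ae P, forall w, (0 <= E n w)%R}.
Proof.
case: model => _ /(_ n) eE _; exists [set w | (E n w < 0)%R]; split.
- rewrite (_ : [set _ | _] = setT `&` E n @^-1` `]-oo, 0%R[).
    by apply: (measurable_E n) => //; exact: measurable_itv.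
  by apply/seteqP; split => w /=; rewrite in_itv/=; [|case].
- exact: (exponential_ge0 lam0 (measurable_E n) eE).
- by move=> w /= /negP; rewrite -ltNge.
Qed.

Lemma ae_Y_gt0 n : {ae P, forall w, (0 < Y n w)%R}.
Proof.
case: model => _ _ /(_ n) pY; exists (Y n @^-1` `]-oo, 0%R]); split.
- by rewrite -[X in measurable X]setTI; apply: (measurable_Y n) => //; exact: measurable_itv.
- rewrite pY// (_ : _ `&` _ = set0) ?integral_set0//.
  by rewrite -subset0 => y [/=]; rewrite in_itv/= leNgt => /negP.
- by move=> w /= /negP; rewrite -leNgt in_itv.
Qed.

Lemma expectation_jump n : \int[P]_w (Num.max (Y n w) 0)%:E = mean_jump.
Proof.
have [g [mg g0 gp g1 gm]] := density_minorant p0 p1.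
case: model => _ _ /(_ n) pY.
rewrite (@expectation_density _ p _ _ P (Y n) (measurable_Y n) pY g mg g0 gp g1
  (fun y => (Num.max y 0)%:E)).
- rewrite /mean_jump -gm; apply: eq_integral => y /set_mem/= y0.
  by rewrite muleC max_l// ltW.
- by apply/measurable_EFinP; apply: measurable_maxr.
- by move=> y; rewrite lee_fin le_max lexx orbT.
Qed.

Lemma mean_jump_gt0 : 0 < mean_jump.
Proof.
rewrite -(expectation_jump 0); apply: expectation_gt0.
- by apply/measurable_EFinP; apply: measurable_maxr => //; exact: measurable_Y.
- by move=> w; rewrite lee_fin le_max lexx orbT.
- by apply: filterS (ae_Y_gt0 0) => w Y0; rewrite lte_fin lt_max Y0.
Qed.

(** The right side involves only [p] and a minorant of it. It therefore identifies the transforms of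
    different jumps, and later those of models living on different probability spaces. *)
Lemma laplace_jump_density n (g : R -> \bar R) :
  measurable_fun setT g -> (forall y, 0 <= g y) ->
  (forall y, (0 < y)%R -> g y <= (p y)%:E) -> \int[mu]_(y in pos) g y = 1 ->
  \int[P]_w (expR (- Y n w))%:E = \int[mu]_(y in pos) (g y * (expR (- y))%:E).
Proof.
move=> mg g0 gp g1.
have mexp : measurable_fun setT (fun y : R => (expR (- y))%:E).
  by apply/measurable_EFinP; apply: measurableT_comp.
case: model => _ _ pY.
by rewrite (@expectation_density _ p _ _ P (Y n) (measurable_Y _) (pY _) g mg g0 gp g1
  (fun y => (expR (- y))%:E))// => y; rewrite lee_fin expR_ge0.
Qed.

Lemma laplace_jumpE n : \int[P]_w (expR (- Y n w))%:E = laplace_jump.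
Proof.
have [g [mg g0 gp g1 _]] := density_minorant p0 p1.
by rewrite /laplace_jump !(laplace_jump_density _ mg g0 gp g1).
Qed.

(** Jump sizes are independent of all waiting times, so [i] and [k] are unrelated. The case [k = i]
    serves to count arrivals; a fixed [k] serves to control a slow start. *)
Lemma expectation_jump_mgf i k (th : R) : (th < lam)%R ->
  \int[P]_w (Num.max (Y i w) 0 * expR (th * arrival E k w))%:E =
  mean_jump * ((lam / (lam - th)) ^+ k.+1)%:E.
Proof.
move=> thl; have [ind eE _] := model.
pose f (b : bool * nat) (y : R) := if b.1 then expR (th * y) else Num.max y 0%R.
have mf b : measurable_fun setT (f b).
  rewrite /f; case: b.1; last exact: measurable_maxr.
  by apply: measurableT_comp.
have f0 b y : (0 <= f b y)%R.
  by rewrite /f; case: b.1; rewrite ?expR_ge0// le_max lexx orbT.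
have us : uniq ((false, i) :: [seq (true, j) | j <- index_iota 0 k.+1]).
  rewrite cons_uniq map_inj_uniq ?iota_uniq ?andbT; last by move=> a b [].
  by apply/negP => /mapP[].
have := expectation_prod_indep ind mf f0 us.
rewrite [in RHS]big_cons [in RHS]big_map big_mkord.
rewrite (eq_bigr (fun=> (lam / (lam - th))%:E)); last first.
  by move=> j _; exact: (exponential_mgf lam0 (measurable_E j) (eE j)).
rewrite [X in X * _](expectation_jump i) prodEFin prodr_const card_ord => <-.
apply: eq_integral => w _; congr EFin.
rewrite big_cons big_map big_mkord /f/= /arrival mulr_sumr expR_sum.
by congr (_ * _)%R; apply: eq_bigr.
Qed.

(** The condition [k < i] keeps [Y i] out of the partial sum, so that all factors are
    independent. *)
Lemma expectation_jump_laplace i k : (k < i)%N ->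
  \int[P]_w (Num.max (Y i w) 0 * expR (- \sum_(j < k.+1) Y j w))%:E =
  mean_jump * laplace_jump ^+ k.+1.
Proof.
move=> ki; have [ind _ _] := model.
pose f (b : bool * nat) (y : R) := if b.2 == i then Num.max y 0%R else expR (- y).
have mf b : measurable_fun setT (f b).
  rewrite /f; case: (b.2 == i); first exact: measurable_maxr.
  by apply: measurableT_comp.
have f0 b y : (0 <= f b y)%R.
  by rewrite /f; case: (b.2 == i); rewrite ?expR_ge0// le_max lexx orbT.
have us : uniq ((false, i) :: [seq (false, j) | j <- index_iota 0 k.+1]).
  rewrite cons_uniq map_inj_uniq ?iota_uniq ?andbT; last by move=> a b [].
  apply/negP => /mapP[j]; rewrite mem_index_iota ltnS => /andP[_ jk] [ij].
  by move: jk; rewrite -ij leqNgt ki.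
have fj w j : (j <= k)%N -> f (false, j) (Y j w) = expR (- Y j w).
  by move=> jk; rewrite /f/= ltn_eqF// (leq_ltn_trans jk).
have := expectation_prod_indep ind mf f0 us.
have fi y : f (false, i) y = Num.max y 0%R by rewrite /f/= eqxx.
rewrite [in RHS]big_cons [in RHS]big_map big_mkord.
rewrite (_ : \int[P]_w (f (false, i) (Y i w))%:E = mean_jump); last first.
  by rewrite -(expectation_jump i); apply: eq_integral => w _; rewrite fi.
rewrite (eq_bigr (fun=> laplace_jump)); last first.
  move=> j _; rewrite -(laplace_jumpE j); apply: eq_integral => w _.
  by rewrite fj// -ltnS.
have powE n : \prod_(j < n) laplace_jump = laplace_jump ^+ n.
  by elim: n => [|n IH]; rewrite ?big_ord0 ?expe0// big_ord_recl IH expeS.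
rewrite powE => <-.
apply: eq_integral => w _; congr EFin.
rewrite big_cons big_map big_mkord fi -sumrN expR_sum.
by congr (_ * _)%R; apply: eq_bigr => j _; rewrite -(fj w j)// -ltnS.
Qed.

Lemma laplace_jump_lt1 : laplace_jump < 1.
Proof.
have mexp : measurable_fun setT (fun w => expR (- Y 0%N w)).
  by apply: measurableT_comp => //; apply: measurableT_comp => //; exact: measurable_Y.
(* The minimum makes [F] nonnegative on every path; [1 - expR (- Y 0 w)] is nonnegative only almost
   surely. *)
pose F w := (1 - Num.min 1 (expR (- Y 0%N w)))%:E.
have mF : measurable_fun setT F.
  apply/measurable_EFinP; apply: measurable_funB => //; exact: measurable_minr.
have F0 w : 0 <= F w by rewrite lee_fin subr_ge0 ge_min lexx.
have Fpos w : (0 < Y 0%N w)%R -> F w = (1 - expR (- Y 0%N w))%:E.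
  by move=> Y0; rewrite /F min_r// -expR0 ler_expR oppr_le0 ltW.
have LF : laplace_jump + \int[P]_w F w = 1.
  have mE : measurable_fun setT (fun w => (expR (- Y 0%N w))%:E : \bar R) by exact/measurable_EFinP.
  have E0 w : setT w -> 0 <= (expR (- Y 0%N w))%:E by rewrite lee_fin expR_ge0.
  rewrite -ge0_integralD//.
  rewrite -[RHS](probability_setT P) -[RHS]mul1e -integral_cst//.
  apply: ge0_ae_eq_integral => //.
  - by apply: emeasurable_funD => //; exact/measurable_EFinP.
  - by move=> w _; rewrite adde_ge0// lee_fin expR_ge0.
  by apply: filterS (ae_Y_gt0 0) => w Y0 _; rewrite Fpos// -EFinD addrC subrK.
have F1 : 0 < \int[P]_w F w.
  apply: expectation_gt0 => //; apply: filterS (ae_Y_gt0 0) => w Y0.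
  by rewrite Fpos// lte_fin subr_gt0 -expR0 ltr_expR oppr_lt0.
have L0 : 0 <= laplace_jump by apply: integral_ge0 => w _; rewrite lee_fin expR_ge0.
have Lfin : laplace_jump \is a fin_num.
  by rewrite ge0_fin_numE// (@le_lt_trans _ _ 1) ?ltry// -LF leeDl// ltW.
by rewrite -LF lteDl.
Qed.

End moments.

(** * Chernoff bounds on arrival times *)

Section geometric_bounds.
Context {R : realType}.
Implicit Types (lam s : R).

(* [M] jumps are counted fully; later ones are charged their Chernoff bound
   [expR (sqrt lam * (s - S_i))], whose means are geometric. *)
Lemma chernoff_upper_sum lam s (c := fun M i => if (i < M)%N then 1 else
    expR (Num.sqrt lam * s) * (lam / (lam + Num.sqrt lam)) ^+ i.+1) :
  0 < lam -> 0 <= s -> exists M, forall N,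
  \sum_(i < N) c M i <= lam * s + (1 + s) * Num.sqrt lam + 1.
Proof.
move=> l0 s0; set q := Num.sqrt lam.
have q0 : 0 < q by rewrite sqrtr_gt0.
have qq : lam = q * q by rewrite -expr2 sqr_sqrtr// ltW.
(* [b = q * s * (q + 1)]. With [r = q / (q + 1) <= expR (- (q + 1)^-1)], any [M >= b] gives
   [expR (q * s) * r ^+ M <= 1]. As [r / (1 - r) = q], the geometric tail then costs at most [q]. *)
pose b := lam * s + s * q.
have b0 : 0 <= b by rewrite addr_ge0// mulr_ge0// ltW.
exists (Num.truncn b).+1; set M := (Num.truncn b).+1 => N.
pose r := lam / (lam + q).
have rE : r = q / (q + 1) by rewrite /r qq; field; rewrite !gt_eqF// ?addr_gt0// mulr_gt0.
have r0 : 0 <= r by rewrite rE divr_ge0// ltW// addr_gt0.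
have c0 i : 0 <= c M i by rewrite /c; case: ifP => // _; rewrite mulr_ge0 ?expR_ge0// exprn_ge0.
apply: (@le_trans _ _ (\sum_(i < M + N) c M i)).
  rewrite addnC -(big_mkord xpredT (c M)) -(big_mkord xpredT (c M)).
  by rewrite (big_cat_nat (leq0n N) (leq_addr M N))/= lerDl sumr_ge0.
have sumE n : \sum_(i < M + n) c M i = M%:R + expR (q * s) * r ^+ M * (q * (1 - r ^+ n)).
  elim: n => [|n IH].
    rewrite addn0 expr0 subrr !mulr0 addr0 (eq_bigr (fun=> 1)); last first.
      by move=> i _; rewrite /c ltn_ord.
    by rewrite sumr_const card_ord.
  rewrite addnS big_ord_recr/= IH /c ltnNge leq_addr/= -/q -/r -addrA; congr (_ + _).
  rewrite -addnS exprD !exprS.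
  have rq : r = q * (1 - r) by rewrite rE; field; rewrite gt_eqF// addr_gt0.
  have -> : q * (1 - r * r ^+ n) = q * (1 - r ^+ n) + q * (1 - r) * r ^+ n by ring.
  rewrite -rq; ring.
rewrite sumE.
have Mb : b <= M%:R by rewrite ltW// truncnS_gt.
have M1 : M%:R <= b + 1 by rewrite /M -natr1 lerD2r truncn_le.
have q1 : 0 < q + 1 by rewrite addr_gt0.
have rM : expR (q * s) * r ^+ M <= 1.
  apply: (@le_trans _ _ (expR (q * s) * expR (- (M%:R / (q + 1))))).
    rewrite ler_wpM2l ?expR_ge0//.
    have -> : - (M%:R / (q + 1)) = - (q + 1)^-1 * M%:R by ring.
    rewrite expRM_natr lerXn2r ?nnegrE ?expR_ge0//.
    apply: le_trans (expR_ge1Dx _).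
    by rewrite le_eqVlt rE; apply/orP; left; apply/eqP; field; rewrite gt_eqF.
  rewrite -expRD -[leRHS]expR0 ler_expR subr_le0 ler_pdivlMr//.
  by apply: (le_trans _ Mb); rewrite /b qq le_eqVlt; apply/orP; left; apply/eqP; ring.
have rn0 : 0 <= r ^+ N by exact: exprn_ge0.
have : expR (q * s) * r ^+ M * (q * (1 - r ^+ N)) <= q.
  apply: (@le_trans _ _ (1 * q)); last by rewrite mul1r.
  have [rN1|rN1] := leP 0 (1 - r ^+ N).
    apply: ler_pM => //; first by rewrite mulr_ge0 ?expR_ge0// exprn_ge0.
      by rewrite mulr_ge0// ltW.
    by rewrite -[leRHS]mulr1 ler_pM2l// lerBlDr lerDl.
  apply: (@le_trans _ _ 0); last by rewrite mul1r ltW.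
  by rewrite mulr_ge0_le0 ?mulr_ge0 ?expR_ge0 ?exprn_ge0// mulr_ge0_le0 ?ltW.
by move=> H; apply: le_trans (lerD M1 H) _; rewrite /b; lra.
Qed.

(** The tilt now has the opposite sign: the arrival of index [i] is later than [s] with probability
    at most [expR (- (sqrt lam * s)) * (lam / (lam - sqrt lam)) ^+ i.+1]. The sum thus bounds the
    mean number of the first [M] arrivals that are missed. The tilt is admissible because
    [1 < lam]. *)
Lemma chernoff_lower_sum lam s : 1 < lam -> 0 <= s -> exists M : nat,
  [/\ lam * s - s * Num.sqrt lam - 1 <= M%:R, M%:R <= lam * s &
  expR (- (Num.sqrt lam * s)) * \sum_(i < M) (lam / (lam - Num.sqrt lam)) ^+ i.+1
    <= Num.sqrt lam].
Proof.
move=> l1 s0; set q := Num.sqrt lam.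
have l0 : 0 < lam by rewrite (lt_trans _ l1).
have q0 : 0 < q by rewrite sqrtr_gt0.
have qq : lam = q * q by rewrite -expr2 sqr_sqrtr// ltW.
have q1 : 1 < q by rewrite -sqrtr1 ltr_sqrt.
have q10 : 0 < q - 1 by rewrite subr_gt0.
(* [b = q * s * (q - 1)] is chosen so that [M <= b] gives [r ^+ M <= expR (M / (q - 1)) <= expR (q *
   s)], where [r = 1 + (q - 1)^-1]. *)
pose b := lam * s - s * q.
have b0 : 0 <= b by rewrite /b qq (_ : _ - _ = q * s * (q - 1)); [rewrite !mulr_ge0// ltW|ring].
exists (Num.truncn b); set M := Num.truncn b.
have Mb : M%:R <= b by rewrite truncn_le.
have M1 : b - 1 <= M%:R by rewrite lerBlDr natr1 ltW// truncnS_gt.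
split => //; first by apply: le_trans Mb _; rewrite /b gerBl mulr_ge0// ltW.
pose r := lam / (lam - q).
have lq : 0 < lam - q by rewrite qq (_ : _ - _ = q * (q - 1)); [rewrite mulr_gt0|ring].
have rE : r = 1 + (q - 1)^-1.
  rewrite /r qq; field.
  by rewrite (gt_eqF q10)/= -qq gt_eqF.
have r0 : 0 <= r by rewrite divr_ge0// ltW.
rewrite -/r.
have sumE n : \sum_(i < n) r ^+ i.+1 = q * (r ^+ n - 1).
  elim: n => [|n IH]; first by rewrite big_ord0 expr0 subrr mulr0.
  rewrite big_ord_recr/= IH !exprS.
  have rq : r = q * (r - 1) by rewrite rE; field; rewrite gt_eqF.
  have -> : q * (r * r ^+ n - 1) = q * (r - 1) * r ^+ n + q * (r ^+ n - 1) by ring.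
  by rewrite -rq addrC.
rewrite sumE.
have rM : r ^+ M <= expR (q * s).
  apply: (@le_trans _ _ (expR ((q - 1)^-1 * M%:R))).
    rewrite expRM_natr lerXn2r ?nnegrE ?expR_ge0// rE.
    exact: expR_ge1Dx.
  rewrite ler_expR mulrC ler_pdivrMr//; apply: le_trans Mb _.
  by rewrite /b qq le_eqVlt; apply/orP; left; apply/eqP; ring.
apply: (@le_trans _ _ (expR (- (q * s)) * (q * expR (q * s)))).
  rewrite ler_wpM2l ?expR_ge0// ler_pM2l//; apply: le_trans _ rM.
  by rewrite gerBl.
by rewrite mulrCA -expRD addrC subrr expR0 mulr1.
Qed.

End geometric_bounds.

(** * Two-sided bounds on the expected revenue *)

Section expected_revenue.
Context {R : realType} {d : measure_display} {Omega : measurableType d}.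
Variables (P : probability Omega R) (lam : R) (p : R -> R) (E Y : nat -> Omega -> R).
Hypothesis lam0 : 0 < lam.
Hypothesis p0 : forall y, 0 < y -> 0 <= p y.
Local Notation mu := lebesgue_measure.
Local Notation pos := [set y : R | (0 < y)%R].
Hypothesis p1 : (\int[mu]_(y in pos) (p y)%:E = 1)%E.
Hypothesis model : compound_poisson_model P lam p E Y.
Hypothesis mean_fin : (mean_jump p < +oo)%E.
Local Open Scope ereal_scope.

(* Agrees almost surely with [jump_process], but is nonnegative and monotone
   on every path. *)
Definition revenue (s : R) (w : Omega) : \bar R :=
  \sum_(i <oo) (Num.max (Y i w) 0 * (arrival E i w <= s)%R%:R)%:E.

(** Stated with finitely many waiting times and jumps rather than as [c <= revenue eps]: its
    complement is covered by two events, each with a Chernoff weight that factorizes. *)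
Definition quick_start (k : nat) (eps c : R) : set Omega :=
  [set w | (arrival E k w <= eps)%R /\ (c <= \sum_(j < k.+1) Y j w)%R].

Lemma revenue_ge0 s w : 0 <= revenue s w.
Proof.
by apply: nneseries_ge0 => i _ _; rewrite lee_fin mulr_ge0// le_max lexx orbT.
Qed.

Let measurable_arrived (s : R) i : measurable [set w | (arrival E i w <= s)%R].
Proof.
rewrite (_ : [set _ | _] = setT `&` arrival E i @^-1` `]-oo, s]).
  by apply: (measurable_arrival model) => //; exact: measurable_itv.
by apply/seteqP; split => w /=; rewrite in_itv/=; [move=> ->|case].
Qed.

Let arrivedE (s : R) i w :
  ((arrival E i w <= s)%R%:R = \1_[set w | (arrival E i w <= s)%R] w :> R)%R.
Proof. by rewrite indicE; congr (nat_of_bool _)%:R; apply/idP/idP; rewrite inE. Qed.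

Let measurable_maxY i : measurable_fun setT (fun w => Num.max (Y i w) 0%R).
Proof. by apply: measurable_maxr => //; exact: (measurable_Y model). Qed.

Let measurable_term (s : R) i :
  measurable_fun setT (fun w => (Num.max (Y i w) 0 * (arrival E i w <= s)%R%:R)%:E).
Proof.
apply/measurable_EFinP/measurable_funM => //.
under eq_fun do rewrite arrivedE.
exact: measurable_indic.
Qed.

Let max0 (y : R) : (0 <= Num.max y 0)%R. Proof. by rewrite le_max lexx orbT. Qed.

Lemma measurable_revenue s : measurable_fun setT (revenue s).
Proof.
apply: ge0_emeasurable_sum => [i w _ _|i _]; first by rewrite lee_fin mulr_ge0.
exact: measurable_term.
Qed.

Lemma measurable_quick_start k eps c : measurable (quick_start k eps c).
Proof.
have -> : quick_start k eps c = [set w | (arrival E k w <= eps)%R] `&`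
    (setT `&` (fun w => \sum_(j < k.+1) Y j w)%R @^-1` `[c, +oo[).
  by apply/seteqP; split => w /=; rewrite /quick_start/= in_itv/= andbT; [move=> [? ?]|case=> ? []].
apply: measurableI; first exact: measurable_arrived.
have mS : measurable_fun setT (fun w => \sum_(j < k.+1) Y j w)%R.
  by apply: measurable_sum => j; exact: (measurable_Y model).
by apply: mS => //; exact: measurable_itv.
Qed.

Let mean_ge0 : 0 <= mean_jump p.
Proof. by rewrite ltW//; exact: (mean_jump_gt0 p0 p1 model). Qed.

Let mean_fin_num : mean_jump p \is a fin_num.
Proof. by rewrite ge0_fin_numE. Qed.

Let measurable_mgf_term i k (th : R) :
  measurable_fun setT (fun w => (Num.max (Y i w) 0 * expR (th * arrival E k w))%:E).
Proof.
apply/measurable_EFinP/measurable_funM => //.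
apply: measurableT_comp => //; apply: measurable_funM => //.
exact: (measurable_arrival model).
Qed.

Lemma expectation_revenue_le s : (0 <= s)%R ->
  \int[P]_w revenue s w <=
  mean_jump p * (lam * s + (1 + s) * Num.sqrt lam + 1)%:E.
Proof.
move=> s0; have [M HM] := chernoff_upper_sum lam0 s0; set q := Num.sqrt lam in HM *.
rewrite integral_nneseries//; last by move=> i w _; rewrite lee_fin mulr_ge0.
apply: lime_le; first by apply: is_cvg_nneseries => i _ _; apply: integral_ge0 => w _; rewrite lee_fin mulr_ge0.
apply: nearW => N; rewrite big_mkord.
apply: (@le_trans _ _ (mean_jump p * (\sum_(i < N) (if (i < M)%N then 1 else
    expR (q * s) * (lam / (lam + q)) ^+ i.+1))%R%:E)); last first.
  by rewrite lee_wpmul2l// lee_fin.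
rewrite -sumEFin ge0_sume_distrr//; last first.
  move=> i _; rewrite lee_fin; case: ifP => // _.
  by rewrite mulr_ge0 ?expR_ge0// exprn_ge0// divr_ge0 ?addr_ge0 ?sqrtr_ge0// ltW.
apply: lee_sum => i _; case: ifPn => iM.
  rewrite mule1 -(expectation_jump p0 p1 model i); apply: ge0_le_integral => //.
  - by move=> w _; rewrite lee_fin mulr_ge0.
  - exact/measurable_EFinP.
  - by move=> w _; rewrite lee_fin ler_piMr// lern1 leq_b1.
have qlam : (- q < lam)%R by rewrite (@le_lt_trans _ _ 0%R)// oppr_le0 sqrtr_ge0.
rewrite EFinM muleCA (_ : (lam + q = lam - - q)%R); last by rewrite opprK.
rewrite -(expectation_jump_mgf lam0 p0 p1 model i i qlam) -ge0_integralZl//; last first.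
  by move=> w _; rewrite lee_fin mulr_ge0// expR_ge0.
apply: ge0_le_integral => //.
- by move=> w _; rewrite lee_fin mulr_ge0.
- exact: measurable_funeM.
move=> w _; rewrite -EFinM lee_fin mulrCA ler_wpM2l// -expRD.
have [arr|_] := leP (arrival E i w) s; last exact: expR_ge0.
by rewrite -expR0 ler_expR mulNr -mulrBr mulr_ge0 ?sqrtr_ge0// subr_ge0.
Qed.

(** For [i > k], the indicator that jump [i] arrives by [s] on the quick start is at least 1 minus
    three Chernoff weights, each of which factorizes against [Y i]. The jumps with [i <= k] enter
    the partial sum of the event and are discarded, at the price of at most [k + 1] means. *)
Lemma expectation_revenue_ge (s eps c : R) (k : nat) : (1 < lam)%R -> (0 <= s)%R ->
  (fine (mean_jump p) * (lam * s * (1 - (expR (- (lam / 2 * eps)) * 2 ^+ k.+1 +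
     expR c * fine (laplace_jump P Y) ^+ k.+1)) - (1 + s) * Num.sqrt lam - k%:R - 2))%:E
  <= \int[P]_w (revenue s w * (\1_(quick_start k eps c) w)%:E).
Proof.
move=> l1 s0; have [M [M1 M2 HM]] := chernoff_lower_sum l1 s0.
set q := Num.sqrt lam in M1 HM *.
set A := quick_start k eps c; have mA : measurable A := measurable_quick_start k eps c.
set m := fine (mean_jump p).
have mE : mean_jump p = m%:E by rewrite fineK.
have m0 : (0 <= m)%R by rewrite fine_ge0.
have L1 := laplace_jump_lt1 model.
have L0 : 0 <= laplace_jump P Y by apply: integral_ge0 => w _; rewrite lee_fin expR_ge0.
have LE : laplace_jump P Y = (fine (laplace_jump P Y))%:E.
  by rewrite fineK// ge0_fin_numE// (lt_trans L1)// ltry.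
set l := fine (laplace_jump P Y) in LE *.
set G := (expR (- (lam / 2 * eps)) * 2 ^+ k.+1 + expR c * l ^+ k.+1)%R.
have l_ge0 : (0 <= l)%R by rewrite fine_ge0.
have G0 : (0 <= G)%R.
  by rewrite addr_ge0// mulr_ge0 ?expR_ge0// exprn_ge0.
pose t i w : R := (Num.max (Y i w) 0 * (arrival E i w <= s)%R%:R * \1_A w)%R.
have t0 i w : (0 <= t i w)%R by rewrite !mulr_ge0.
have mt i : measurable_fun setT (fun w => (t i w)%:E).
  apply/measurable_EFinP/measurable_funM => //.
  exact/measurable_EFinP/measurable_term.
have tle i : \int[P]_w (t i w)%:E <= m%:E.
  rewrite -mE -(expectation_jump p0 p1 model i); apply: ge0_le_integral => //.
  - by move=> w _; rewrite lee_fin.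
  - exact/measurable_EFinP.
  - move=> w _; rewrite lee_fin /t -mulrA ler_piMr//.
    by rewrite indicE -natrM mulnb lern1 leq_b1.
pose a i := fine (\int[P]_w (t i w)%:E).
have aE i : \int[P]_w (t i w)%:E = (a i)%:E.
  by rewrite fineK// ge0_fin_numE ?(le_lt_trans (tle i)) ?ltry// integral_ge0// => w _; rewrite lee_fin.
have a0 i : (0 <= a i)%R.
  by rewrite fine_ge0// integral_ge0// => w _; rewrite lee_fin.
have q0 : (0 < q)%R by rewrite sqrtr_gt0.
have q1 : (1 < q)%R by rewrite -sqrtr1 ltr_sqrt.
have qq : (lam = q * q)%R by rewrite -expr2 sqr_sqrtr// ltW.
have qlam : (q < lam)%R by rewrite [ltRHS]qq ltr_pMr.
have hlam : (lam / 2 < lam)%R by rewrite ltr_pdivrMr// ltr_pMr// ltr1n.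
pose err i : R := (expR (- (q * s)) * (lam / (lam - q)) ^+ i.+1 + G)%R.
have aL i : (m * (1 - err i - (i <= k)%N%:R) <= a i)%R.
  have err0 : (0 <= err i)%R.
    by rewrite addr_ge0// mulr_ge0 ?expR_ge0// exprn_ge0// divr_ge0 ?(ltW lam0)// subr_ge0 ltW.
  have [ik|ki] := leqP i k.
    rewrite (le_trans _ (a0 i))// mulr_ge0_le0//=.
    by rewrite -addrA -opprD subr_le0 lerDr.
  rewrite subr0 mulrBr mulr1 lerBlDr -lee_fin EFinD -aE -mE.
  (* The three terms dominate the jump when, respectively, it arrives after [s], the arrival of
     index [k] comes after [eps], or the first [k + 1] jumps sum to less than [c]. *)
  pose f1 w : \bar R := (expR (- (q * s)))%:E * (Num.max (Y i w) 0 * expR (q * arrival E i w))%:E.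
  pose f2 w : \bar R := (expR (- (lam / 2 * eps)))%:E *
     (Num.max (Y i w) 0 * expR (lam / 2 * arrival E k w))%:E.
  pose f3 w : \bar R := (expR c)%:E * (Num.max (Y i w) 0 * expR (- \sum_(j < k.+1) Y j w))%:E.
  have mlap : measurable_fun setT (fun w => (Num.max (Y i w) 0 * expR (- \sum_(j < k.+1) Y j w))%:E).
    apply/measurable_EFinP/measurable_funM => //.
    do 2 (apply: measurableT_comp => //).
    by apply: measurable_sum => j; exact: (measurable_Y model).
  have mf1 : measurable_fun setT f1 by exact: measurable_funeM.
  have mf2 : measurable_fun setT f2 by exact: measurable_funeM.
  have mf3 : measurable_fun setT f3 by exact: measurable_funeM.
  have e0 x : (0 <= expR x :> R)%R by exact: expR_ge0.
  have f10 w : 0 <= f1 w by rewrite /f1 -EFinM lee_fin !mulr_ge0.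
  have f20 w : 0 <= f2 w by rewrite /f2 -EFinM lee_fin !mulr_ge0.
  have f30 w : 0 <= f3 w by rewrite /f3 -EFinM lee_fin !mulr_ge0.
  have If1 : \int[P]_w f1 w = (m * (expR (- (q * s)) * (lam / (lam - q)) ^+ i.+1))%:E.
    rewrite ge0_integralZl//; last by move=> w _; rewrite lee_fin mulr_ge0.
    by rewrite (expectation_jump_mgf lam0 p0 p1 model) // mE -!EFinM mulrCA.
  have If2 : \int[P]_w f2 w = (m * (expR (- (lam / 2 * eps)) * 2 ^+ k.+1))%:E.
    rewrite ge0_integralZl//; last by move=> w _; rewrite lee_fin mulr_ge0.
    rewrite (expectation_jump_mgf lam0 p0 p1 model) // mE -!EFinM mulrCA.
    (* The tilt [lam / 2] halves the rate, so each of the [k + 1] waiting times contributes a factor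
       2. *)
    have -> : (lam / (lam - lam / 2) = 2)%R; last by [].
    have -> : (lam - lam / 2 = lam / 2)%R by lra.
    by rewrite invf_div mulrC divfK// gt_eqF.
  have If3 : \int[P]_w f3 w = (m * (expR c * l ^+ k.+1))%:E.
    rewrite ge0_integralZl//; last by move=> w _; rewrite lee_fin mulr_ge0.
    by rewrite (expectation_jump_laplace p0 p1 model)// mE LE -EFin_expe -!EFinM mulrCA.
  have -> : (m * err i)%:E = \int[P]_w (f1 w + (f2 w + f3 w)).
    rewrite ge0_integralD//; last 2 first.
    - by move=> w _; rewrite adde_ge0.
    - exact: emeasurable_funD.
    rewrite ge0_integralD// If1 If2 If3 -!EFinD; congr EFin.
    by rewrite /err /G; ring.
  rewrite -(expectation_jump p0 p1 model i) -ge0_integralD//; last 3 first.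
  - by move=> w _; rewrite lee_fin.
  - by move=> w _; rewrite !adde_ge0.
  - by do 2 apply: emeasurable_funD => //.
  apply: ge0_le_integral => //.
  - by move=> w _; rewrite lee_fin.
  - exact/measurable_EFinP.
  - by apply: emeasurable_funD => //; do 2 apply: emeasurable_funD => //.
  move=> w _; rewrite /f1 /f2 /f3 -!EFinM -!EFinD lee_fin /t.
  set y := Num.max (Y i w) 0%R.
  rewrite [leRHS](_ : _ = (y * ((arrival E i w <= s)%R%:R * \1_A w +
    (expR (- (q * s)) * expR (q * arrival E i w) +
    (expR (- (lam / 2 * eps)) * expR (lam / 2 * arrival E k w) +
     expR c * expR (- \sum_(j < k.+1) Y j w)))))%R); last by ring.
  rewrite -[leLHS]mulr1.
  apply: ler_wpM2l; first exact: max0.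
  rewrite -!expRD.
  have [arr|arr] := leP (arrival E i w) s; last first.
    rewrite mul0r add0r -[leLHS]addr0 lerD ?addr_ge0//.
    by rewrite -expR0 ler_expR addrC -mulrBr mulr_ge0 ?ltW// subr_gt0.
  rewrite mul1r.
  have [wA|wA] := pselect (A w).
    by rewrite indicE mem_set// lerDl !addr_ge0.
  rewrite indicE memNset// add0r.
  have [arrk|arrk] := leP (arrival E k w) eps; last first.
    rewrite addrCA -[leLHS]addr0 lerD ?addr_ge0//.
    by rewrite -expR0 ler_expR addrC -mulrBr mulr_ge0 ?divr_ge0 ?ltW// subr_gt0.
  have [cY|cY] := leP c (\sum_(j < k.+1) Y j w)%R; first by exfalso; apply: wA; split.
  rewrite addrA -[leLHS]add0r lerD ?addr_ge0//.
  by rewrite -expR0 ler_expR subr_ge0 ltW.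
have kM : (\sum_(i < M) (i <= k)%N%:R <= k%:R + 1 :> R)%R.
  rewrite -natr_sum natr1 ler_nat.
  suff -> : (\sum_(i < M) (i <= k) = minn M k.+1)%N by exact: geq_minr.
  elim: M {M1 M2 HM} => [|M IH]; first by rewrite big_ord0 min0n.
  rewrite big_ord_recr/= IH; have [Mk|kM] := leqP M k.
    by rewrite (minn_idPl (leqW Mk)) addn1 (minn_idPl _).
  by rewrite (minn_idPr kM) addn0 (minn_idPr (leqW kM)).
(* The constant [k + 2] collects the [k + 1] discarded indices and the rounding of [M]. *)
have suma : (m * (lam * s * (1 - G) - (1 + s) * q - k%:R - 2) <= \sum_(i < M) a i)%R.
  apply: (@le_trans _ _ (\sum_(i < M) m * (1 - err i - (i <= k)%N%:R))%R); last first.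
    by apply: ler_sum => i _; exact: aL.
  rewrite -mulr_sumr ler_wpM2l// !sumrB /err big_split/= !sumr_const card_ord -mulr_sumr.
  have : (G * M%:R <= G * (lam * s))%R by rewrite ler_wpM2l.
  rewrite -[(G *+ M)%R]mulr_natr => GM.
  move: M1 HM kM GM; set S1 := (_ * \sum_(_ < _) _)%R; set S2 := (\sum_(_ < _) _%:R)%R.
  by move=> *; lra.
apply: (@le_trans _ _ (\sum_(i < M) a i)%R%:E); first by rewrite lee_fin.
rewrite -sumEFin (eq_bigr (fun i : 'I_M => \int[P]_w (t i w)%:E)); last by move=> i _; rewrite aE.
rewrite -ge0_integral_sum//; last by move=> i w _; rewrite lee_fin.
apply: ge0_le_integral => //.
- by move=> w _; apply: sume_ge0 => i _; rewrite lee_fin.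
- by apply: emeasurable_sum.
- by apply: emeasurable_funM; [exact: measurable_revenue|exact/measurable_EFinP].
move=> w _; rewrite sumEFin -mulr_suml EFinM lee_wpmul2r// ?lee_fin// -sumEFin.
rewrite -(big_mkord xpredT (fun i => (Num.max (Y i w) 0 * (arrival E i w <= s)%R%:R)%:E)).
by apply: nneseries_lim_ge => i _; rewrite lee_fin mulr_ge0.
Qed.

End expected_revenue.

(** * Upper bound *)

Section stieltjes.
Context {R : realType}.
Implicit Types (f : cumulative R R) (A : set R).
Local Open Scope ereal_scope.

Lemma lebesgue_stieltjes_itv f (a b : R) : (a <= b)%R ->
  lebesgue_stieltjes_measure f `]a, b] = (f b - f a)%:E.
Proof.
move=> ab; rewrite /lebesgue_stieltjes_measure /measure_extension/=.
by rewrite measurable_mu_extE/=; [rewrite wlength_itv_bnd|exact: is_ocitv].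
Qed.

(** [A] is an interval starting at 0, closed or open at its right end. In the open case a jump of
    [f] at the end carries no mass on [A], so bounds at the points of [A] suffice. *)
Lemma lebesgue_stieltjes_initial_le f A (u : R) (C : \bar R) :
  measurable A -> (forall t, (t < 0)%R -> f t = 0%R) ->
  (forall t, A t -> (0 <= t <= u)%R) ->
  (forall s t, A t -> (0 <= s <= t)%R -> A s) ->
  0 <= C -> (forall t, A t -> (f t)%:E <= C) ->
  lebesgue_stieltjes_measure f A <= C.
Proof.
move=> mA fneg Au Adown C0 fC.
have [->|/set0P[a Aa]] := eqVneq A set0; first by rewrite measure0.
have supA : has_sup A by split; [exists a|exists u => t /Au/andP[]].
set b := sup A.
have Ab t : A t -> (t <= b)%R by move=> At; exact: sup_upper_bound.
have fle t : (0 <= t)%R -> (t < b)%R -> (f t)%:E <= C.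
  move=> t0 tb; apply: fC; have bt : (0 < b - t)%R by rewrite subr_gt0.
  have [s As] := sup_adherent bt supA; rewrite subKr => ts.
  by apply: Adown As _; rewrite t0 ltW.
have N10 : f (-1)%R = 0%R by apply: fneg; rewrite ltrN10.
have b0 : (0 <= b)%R by have /andP[a0 _] := Au _ Aa; exact: le_trans a0 (Ab _ Aa).
have [bA|bA] := pselect (A b).
  (* Starting at [-1], where [f] vanishes, includes a lump sum paid at time 0. *)
  apply: (@le_trans _ _ (lebesgue_stieltjes_measure f `](-1)%R, b])).
    apply: le_measure; rewrite ?inE//.
    move=> t At; rewrite /= in_itv/= Ab// andbT.
    by have /andP[t0 _] := Au _ At; rewrite (lt_le_trans _ t0)// ltrN10.
  rewrite lebesgue_stieltjes_itv ?N10 ?subr0; first exact: fC.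
  by rewrite (le_trans _ b0)// lerN10.
(* The end [b] is not in [A]: exhausting from inside by right-closed intervals avoids evaluating [f]
   at [b]. *)
pose F n : set R := `](-1)%R, (b - n.+1%:R^-1)%R]%classic.
have mF n : measurable (F n) by exact: measurable_itv.
have ndF : nondecreasing_seq F.
  move=> m n mn; apply/subsetPset => t; rewrite /F /= !in_itv/= => /andP[-> tm]/=.
  apply: (le_trans tm); rewrite lerD2l lerN2 lef_pV2 ?posrE ?ltr0n//.
  by rewrite ler_nat.
have AF : A `<=` \bigcup_n F n.
  move=> t At; have /andP[t0 _] := Au _ At.
  have tb : (0 < b - t)%R.
    rewrite subr_gt0 lt_neqAle Ab// andbT; apply/eqP => tb.
    by apply: bA; rewrite -tb.
  exists (Num.truncn (b - t)^-1) => //; rewrite /F /= in_itv/=.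
  rewrite (lt_le_trans _ t0) ?ltrN10//= lerBrDr -lerBrDl.
  rewrite -[leRHS]invrK lef_pV2 ?posrE ?invr_gt0//.
  by rewrite ltW// truncnS_gt.
apply: (@le_trans _ _ (lebesgue_stieltjes_measure f (\bigcup_n F n))).
  apply: le_measure; rewrite ?inE//; exact: bigcupT_measurable.
have := nondecreasing_cvg_mu (mu := lebesgue_stieltjes_measure f) mF (bigcupT_measurable _ mF) ndF.
move=> /cvg_lim <- //; apply: lime_le.
  apply: ereal_nondecreasing_is_cvgn => m n mn; apply: le_measure; rewrite ?inE//.
  - exact: mF.
  - exact: mF.
  - by have /subsetPset := ndF _ _ mn.
apply: nearW => n; rewrite /= /F; set e : R := (n.+1%:R^-1)%R.
have e0 : (0 < e)%R by rewrite invr_gt0 ltr0n.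
have e1 : (e <= 1)%R by rewrite invf_le1 ?ltr0n// ler1n.
rewrite lebesgue_stieltjes_itv ?N10 ?subr0; last by lra.
have [be0|be0] := leP 0%R (b - e)%R; last by rewrite fneg.
by apply: fle => //; lra.
Qed.

End stieltjes.

Section pathwise_upper.
Context {R : realType} {d : measure_display} {Omega : measurableType d}.
Variables (E Y : nat -> Omega -> R) (w : Omega).
Hypothesis Y0 : forall i, 0 <= Y i w.
Local Open Scope ereal_scope.

Lemma jump_processE t : jump_process E Y t w = revenue E Y t w.
Proof.
rewrite /jump_process eseries_mkcond; apply: eq_eseriesr => i _.
by rewrite max_l//; case: ifPn; rewrite ?mulr1 ?mulr0.
Qed.

Lemma revenue_nd (s t : R) : (s <= t)%R -> revenue E Y s w <= revenue E Y t w.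
Proof.
move=> st; apply: lee_nneseries => i _.
  by rewrite lee_fin mulr_ge0// le_max lexx orbT.
rewrite lee_fin ler_wpM2l ?le_max ?lexx ?orbT// ler_nat.
by case: (leP (arrival E i w) s) => // /le_trans -> .
Qed.

Variables (x rho : R) (D : Omega -> cumulative R R).
Hypothesis x0 : (0 <= x)%R.
Hypothesis rho0 : (0 <= rho)%R.
Hypothesis Dneg : forall t, (t < 0)%R -> D w t = 0%R.
Let tau := ruin_time x rho E Y D w.

Let D_le_revenue (t : R) : (0 < t)%R -> t%:E < tau -> (D w t)%:E <= x%:E + revenue E Y t w.
Proof.
move=> t0 ttau.
have : 0 < surplus x rho E Y D t w.
  rewrite ltNge; apply/negP => st; move: ttau; apply/negP; rewrite -leNgt.
  by apply: ereal_inf_lbound; exists t.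
rewrite /surplus jump_processE.
have := revenue_ge0 E Y t w; case: (revenue E Y t w) => [r r0| |//].
  rewrite -!EFinD lte_fin lee_fin => H.
  have : (0 <= rho * t)%R by rewrite mulr_ge0// ltW.
  lra.
by move=> _ _; rewrite addey// leey.
Qed.

Let paid_before_ruin (T : \bar R) := [set t : R | (0 <= t)%R /\ t%:E < Order.min T tau].

Lemma measurable_paid_before_ruin T : measurable (paid_before_ruin T).
Proof.
rewrite /paid_before_ruin; case: (Order.min T tau) => [b| |].
- rewrite (_ : [set _ | _] = `[0%R, b[%classic); first exact: measurable_itv.
  by apply/seteqP; split => t /=; rewrite in_itv/= lte_fin => /andP.
- rewrite (_ : [set _ | _] = `[0%R, +oo[%classic); first exact: measurable_itv.
  by apply/seteqP; split => t /=; rewrite in_itv/= andbT ?ltry//; case.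
- by rewrite (_ : [set _ | _] = set0)// -subset0 => t [_].
Qed.

(** The cell end [u] may lie beyond the horizon, whereas the revenue that can be paid out is only
    that collected up to [v]. *)
Lemma dividends_before_le (T : \bar R) (u v : R) : (0 <= v)%R ->
  (forall t, (0 <= t)%R -> t%:E < T -> (t < u)%R -> (t <= v)%R) ->
  lebesgue_stieltjes_measure (D w) (paid_before_ruin T `&` [set t | (t < u)%R]) <=
  x%:E + revenue E Y v w.
Proof.
move=> v0 uv.
have C0 : 0 <= x%:E + revenue E Y v w by rewrite adde_ge0 ?lee_fin ?revenue_ge0.
apply: (@lebesgue_stieltjes_initial_le _ _ _ v) => //.
- apply: measurableI; first exact: measurable_paid_before_ruin.
  by rewrite (_ : [set t | _] = `]-oo, u[%classic)//; apply/seteqP; split => t /=; rewrite in_itv.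
- move=> t [[t0]]; rewrite lt_min => /andP[tT _] tu; rewrite t0; exact: uv.
- move=> s t [[t0 tT] tu] /andP[s0 st]; split; last exact: le_lt_trans tu.
  by split => //; apply: le_lt_trans tT; rewrite lee_fin.
move=> t [[t0 tm] tu].
(* Ruin is tested at positive times only, so nothing is known directly at [t = 0]. The bound is
   taken at a slightly later [t'], still before ruin, and carried back by monotonicity of the
   dividends. *)
have [t' tt' [t'm t'u]] : exists2 t', (t < t')%R & t'%:E < Order.min T tau /\ (t' < u)%R.
  move: tm; case: (Order.min T tau) => [b| |//].
    rewrite lte_fin => tb; exists ((t + Num.min b u) / 2)%R.
      by rewrite midf_lt// lt_min tb.
    have : ((t + Num.min b u) / 2 < Num.min b u)%R by rewrite midf_lt// lt_min tb.
    by rewrite lt_min => /andP[].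
  by move=> _; exists ((t + u) / 2)%R; rewrite ?ltry ?midf_lt.
have t'0 : (0 < t')%R by exact: le_lt_trans tt'.
move: t'm; rewrite lt_min => /andP[t'T t'tau].
apply: (@le_trans _ _ (D w t')%:E).
  by rewrite lee_fin; apply: cumulative_is_nondecreasing; exact: ltW.
apply: le_trans (D_le_revenue t'0 t'tau) _.
by rewrite leeD2l// revenue_nd// uv// ltW.
Qed.

(* [expR (- delta * t)] is dominated by a step function, constant on the cells
   of a grid of mesh [h] and decomposed into indicators of initial segments. *)
Lemma discounted_path_le (T : \bar R) (delta h : R) (v : nat -> R) :
  (0 < delta)%R -> (0 < h)%R -> (forall j, 0 <= v j)%R ->
  (forall j t, (0 <= t)%R -> t%:E < T -> (t < j.+1%:R * h)%R -> (t <= v j)%R) ->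
  \int[lebesgue_stieltjes_measure (D w)]_(t in paid_before_ruin T)
     (expR (- (delta * t)))%:E <=
  \sum_(j <oo) ((1 - expR (- (delta * h))) * expR (- (delta * h)) ^+ j)%:E *
     (x%:E + revenue E Y (v j) w).
Proof.
move=> d0 h0 v0 vP; set r := expR (- (delta * h)).
have r0 : (0 <= r)%R by exact: expR_ge0.
have r1 : (r < 1)%R by rewrite -expR0 ltr_expR oppr_lt0 mulr_gt0.
pose B j := [set t : R | (t < j.+1%:R * h)%R].
have mB j : measurable (B j).
  rewrite (_ : B j = `]-oo, (j.+1%:R * h)%R[%classic); first exact: measurable_itv.
  by apply/seteqP; split => t /=; rewrite in_itv.
have mD := measurable_paid_before_ruin T.
pose a j : R := ((1 - r) * r ^+ j)%R.
have a0 j : (0 <= a j)%R by rewrite mulr_ge0 ?exprn_ge0// subr_ge0 ltW.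
have ma j : measurable_fun (paid_before_ruin T) (fun t => (a j * \1_(B j) t)%:E).
  apply/measurable_EFinP; apply: measurable_funM => //; exact: measurable_indic.
apply: (@le_trans _ _ (\int[lebesgue_stieltjes_measure (D w)]_(t in paid_before_ruin T)
    \sum_(j <oo) (a j * \1_(B j) t)%:E)).
  apply: le_lower_integral => t [t0 _]; first by rewrite lee_fin expR_ge0.
  (* [t] belongs to [B j] exactly when [m <= j], so the series telescopes to [r ^+ m], the discount
     factor at the left end of the cell of [t]. *)
  pose m := Num.truncn (t / h).
  have th0 : (0 <= t / h)%R by rewrite divr_ge0// ltW.
  have mt : (m%:R * h <= t)%R by rewrite -ler_pdivlMr// truncn_le.
  have tm : (t < m.+1%:R * h)%R by rewrite -ltr_pdivrMr// truncnS_gt.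
  have part n : (r ^+ m - r ^+ n <= \sum_(0 <= j < n) a j * \1_(B j) t)%R.
    elim: n => [|n IH].
      by rewrite big_nil subr_le0 expr0 exprn_ile1// ltW.
    rewrite big_nat_recr//=; have [mn|nm] := leqP m n.
      rewrite indicE mem_set ?mulr1; last first.
        rewrite /B/=; apply: (lt_le_trans tm).
        by apply: ler_wpM2r; [exact: ltW|rewrite ler_nat ltnS].
      rewrite /a exprS; lra.
    apply: (@le_trans _ _ 0%R).
      by rewrite subr_le0; apply: ler_wiXn2l => //; exact: ltW.
    by apply: addr_ge0; [apply: sumr_ge0 => j _|]; exact: mulr_ge0.
  apply: (@le_trans _ _ (r ^+ m)%:E).
    rewrite lee_fin /r -expRM_natl ler_expR mulrN lerN2 mulrCA.
    by rewrite ler_wpM2l// ltW.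
  have cv : (r ^+ m - r ^+ n)%:E @[n --> \oo] --> (r ^+ m)%:E.
    apply/fine_cvgP; split; first exact: nearW.
    rewrite -[X in _ --> X]subr0; apply: cvgB; first exact: cvg_cst.
    by apply: cvg_expr; rewrite ger0_norm.
  rewrite -(cvg_lim _ cv)//; apply: lee_lim.
  - by apply/cvg_ex; exists (r ^+ m)%:E.
  - by apply: is_cvg_nneseries => j _ _; rewrite lee_fin mulr_ge0.
  - by apply: nearW => n; rewrite sumEFin lee_fin.
rewrite integral_nneseries//; last by move=> j t _; rewrite lee_fin mulr_ge0.
apply: lee_nneseries => j _.
  by move=> _; apply: integral_ge0 => t _; rewrite lee_fin mulr_ge0.
under eq_integral do rewrite EFinM.
rewrite (_ : \int[_]_(t in _) _ = (a j)%:E * \int[lebesgue_stieltjes_measure (D w)]_(t in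
    paid_before_ruin T) (\1_(B j) t)%:E); last first.
  apply: ge0_integralZl; first exact: mD.
  - by apply/measurable_EFinP; apply: measurable_indic; exact: mB.
  - by move=> t _; rewrite lee_fin.
  - by rewrite lee_fin.
rewrite lee_wpmul2l ?lee_fin//.
rewrite integral_indic; [|exact: mD|exact: mB]; rewrite setIC.
by apply: dividends_before_le => //; exact: vP.
Qed.

End pathwise_upper.

(** Since [f] may fail to be measurable, it is not modified. Instead [g] is raised to [+oo] on the
    exceptional null set, which leaves its integral unchanged and makes the inequality hold
    everywhere. *)
Lemma le_lower_integral_ae {d} {T : measurableType d} {R : realType}
    (mu : {measure set T -> \bar R}) (f g : T -> \bar R) :
  (forall x, 0 <= f x)%E -> measurable_fun setT g -> (forall x, 0 <= g x)%E ->
  {ae mu, forall x, (f x <= g x)%E} ->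
  (\int[mu]_x f x <= \int[mu]_x g x)%E.
Proof.
move=> f0 mg g0 [N [mN N0 sub]].
pose g' x := (g x + +oo * (\1_N x)%:E)%E.
have g'N x : x \in N -> g' x = +oo%E.
  move=> xN; rewrite /g' indicE xN mule1 addey//.
  by rewrite gt_eqF// (lt_le_trans _ (g0 x)).
have g'E x : x \notin N -> g' x = g x.
  by move=> /negbTE xN; rewrite /g' indicE xN mule0 adde0.
have mg' : measurable_fun setT g'.
  apply: emeasurable_funD => //; apply: measurable_funeM.
  by apply/measurable_EFinP; exact: measurable_indic.
apply: (@le_trans _ _ (\int[mu]_x g' x)%E).
  apply: le_lower_integral => // x _.
  have [xN|xN] := boolP (x \in N); first by rewrite g'N// leey.
  rewrite g'E//; apply: contrapT => fg; move/negP: xN; apply.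
  exact/mem_set/sub.
rewrite (_ : \int[mu]_x g' x = \int[mu]_x g x)%E//.
apply: ge0_ae_eq_integral => //.
  by move=> x _; have [xN|xN] := boolP (x \in N); [rewrite g'N|rewrite g'E].
exists N; split => // x /= /not_implyP[_].
by apply: contra_notP => xN; rewrite g'E// notin_setE.
Qed.

(** * Geometric weights and the discount integral *)

Section abel_bounds.
Context {R : realType}.
Implicit Types (r h delta : R).

(** Summation by parts. Times the mesh, [minn j.+1 N] is a cell end truncated at the horizon, and
    the right side is a left Riemann sum of the discount factor. *)
Lemma geometric_abel_sum r (N n : nat) :
  \sum_(j < n) (1 - r) * r ^+ j * (minn j.+1 N)%:R + r ^+ n * (minn n N)%:R =
  \sum_(i < minn n N) r ^+ i.
Proof.
elim: n => [|n IH]; first by rewrite !big_ord0 min0n mulr0 addr0 big_ord0.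
rewrite big_ord_recr/=; have [nN|Nn] := ltnP n N.
  move: IH; rewrite (minn_idPl nN) (minn_idPl (ltnW nN)) => IH.
  by rewrite big_ord_recr/= -IH exprS -natr1; ring.
move: IH; rewrite (minn_idPr Nn) (minn_idPr (leqW Nn)) => <-.
by rewrite exprS; ring.
Qed.

(** The geometric sum is [(1 - r ^+ N) / (1 - r)], and [h / (1 - r) <= (1 + delta * h) / delta]
    amounts to [r * (1 + delta * h) <= 1], which is [1 + y <= expR y]. *)
Lemma geometric_sum_le delta h (N : nat) (r := expR (- (delta * h))) :
  0 < delta -> 0 < h -> h * \sum_(i < N) r ^+ i <= (1 - r ^+ N) * ((1 + delta * h) / delta).
Proof.
move=> d0 h0; have dh : 0 < delta * h by rewrite mulr_gt0.
have r1 : r < 1 by rewrite -expR0 ltr_expR oppr_lt0.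
have r0 : 0 <= r by exact: expR_ge0.
have sumE : (1 - r) * \sum_(i < N) r ^+ i = 1 - r ^+ N.
  elim: N => [|N IH]; first by rewrite big_ord0 mulr0 expr0 subrr.
  by rewrite big_ord_recr/= mulrDr IH exprS; ring.
have S0 : 0 <= \sum_(i < N) r ^+ i by apply: sumr_ge0 => i _; exact: exprn_ge0.
rewrite -sumE [leRHS]mulrAC; apply: ler_wpM2r => //.
rewrite mulrA ler_pdivlMr//.
have : r * (1 + delta * h) <= 1.
  rewrite /r expRN mulrC ler_pdivrMr ?expR_gt0// mul1r; exact: expR_ge1Dx.
lra.
Qed.

Lemma geometric_mean_time_le delta h (N n : nat) (r := expR (- (delta * h))) :
  0 < delta -> 0 < h ->
  \sum_(j < n) (1 - r) * r ^+ j * ((minn j.+1 N)%:R * h) <=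
  (1 - r ^+ N) * ((1 + delta * h) / delta).
Proof.
move=> d0 h0; apply: le_trans (geometric_sum_le N d0 h0); rewrite -/r.
have r0 : 0 <= r by exact: expR_ge0.
rewrite (eq_bigr (fun j : 'I_n => h * ((1 - r) * r ^+ j * (minn j.+1 N)%:R))); last first.
  by move=> j _; ring.
rewrite -mulr_sumr ler_pM2l//.
apply: (@le_trans _ _ (\sum_(i < minn n N) r ^+ i)).
  by rewrite -geometric_abel_sum lerDl mulr_ge0// exprn_ge0.
rewrite -(big_mkord xpredT (fun i => r ^+ i)) -(big_mkord xpredT (fun i => r ^+ i)).
rewrite (big_cat_nat (leq0n _) (geq_minr n N))/= lerDl.
by apply: sumr_ge0 => i _; exact: exprn_ge0.
Qed.

Lemma geometric_mean_time_le_infty delta h (n : nat) (r := expR (- (delta * h))) :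
  0 < delta -> 0 < h ->
  \sum_(j < n) (1 - r) * r ^+ j * (j.+1%:R * h) <= (1 + delta * h) / delta.
Proof.
move=> d0 h0.
have r0 : 0 <= r by exact: expR_ge0.
apply: (@le_trans _ _ ((1 - r ^+ n) * ((1 + delta * h) / delta))).
  apply: le_trans (geometric_mean_time_le n n d0 h0); rewrite -/r.
  by apply: ler_sum => j _; rewrite (minn_idPl (ltn_ord j)).
rewrite ler_piMl ?divr_ge0 ?addr_ge0 ?mulr_ge0 ?(ltW d0) ?(ltW h0)//.
by rewrite gerBl exprn_ge0.
Qed.

Lemma le_ereal_of_harmonic (V : \bar R) (a b : R) : 0 <= b ->
  (forall n : nat, V <= (a + b / n.+1%:R)%:E)%E -> (V <= a%:E)%E.
Proof.
move=> b0 H; apply/lee_addgt0Pr => e e0.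
apply: le_trans (H (Num.truncn (b / e))) _; rewrite -EFinD lee_fin lerD2l.
rewrite ler_pdivrMr ?ltr0n// mulrC -ler_pdivrMr// ltW//.
exact: truncnS_gt.
Qed.

End abel_bounds.

Section value_upper.
Context {R : realType} {d : measure_display} {Omega : measurableType d}.
Variables (P : probability Omega R) (lam : R) (p : R -> R) (E Y : nat -> Omega -> R).
Hypothesis lam0 : 0 < lam.
Hypothesis p0 : forall y, 0 < y -> 0 <= p y.
Local Notation mu := lebesgue_measure.
Local Notation pos := [set y : R | (0 < y)%R].
Hypothesis p1 : (\int[mu]_(y in pos) (p y)%:E = 1)%E.
Hypothesis model : compound_poisson_model P lam p E Y.
Hypothesis mean_fin : (mean_jump p < +oo)%E.
Variables (x rho : R).
Hypotheses (x0 : 0 <= x) (rho0 : 0 <= rho).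
Local Open Scope ereal_scope.
Local Notation m := (fine (mean_jump p)).
Local Notation q := (Num.sqrt lam).

Lemma ae_nonneg_increments : {ae P, forall w, forall i, (0 <= Y i w)%R /\ (0 <= E i w)%R}.
Proof.
apply: ae_foralln => i.
by apply: filterS2 (ae_Y_gt0 model i) (ae_E_ge0 lam0 model i) => w /ltW.
Qed.

Let mE : mean_jump p = m%:E.
Proof.
rewrite fineK// ge0_fin_numE// ltW//; exact: (mean_jump_gt0 p0 p1 model).
Qed.

Let m0 : (0 <= m)%R.
Proof. by rewrite fine_ge0// ltW//; exact: (mean_jump_gt0 p0 p1 model). Qed.

Let q0 : (0 <= q)%R. Proof. exact: sqrtr_ge0. Qed.

Let erev (s : R) : (0 <= s)%R ->
  \int[P]_w revenue E Y s w <= (m * (lam * s + (1 + s) * q + 1))%:E.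
Proof.
by move=> s0; rewrite EFinM -mE; exact: (expectation_revenue_le lam0 p0 p1 model).
Qed.

Let erev_shift (s : R) : (0 <= s)%R ->
  \int[P]_w (x%:E + revenue E Y s w) <= (x + m * (lam * s + (1 + s) * q + 1))%:E.
Proof.
move=> s0; have mrev := measurable_revenue model s.
have rev0 w : setT w -> 0 <= revenue E Y s w by move=> _; exact: revenue_ge0.
have xx0 w : setT w -> 0 <= (cst x%:E : Omega -> \bar R) w by rewrite lee_fin.
have -> : \int[P]_w (x%:E + revenue E Y s w) = \int[P]_w cst x%:E w + \int[P]_w revenue E Y s w.
  exact: (ge0_integralD P measurableT xx0 (measurable_cst _) rev0 mrev).
have -> : \int[P]_w cst x%:E w = x%:E.
  rewrite (integral_cst P measurableT) -[RHS]mule1.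
  by congr (_ * _); exact: probability_setT.
by rewrite EFinD; apply: leeD2l; exact: erev.
Qed.

(** The bound on expected revenue is affine in time and the geometric weights sum to at most 1.
    Hence the constants enter once, and the times [v j] enter only through a bound [K] on their
    weighted sum. *)
Lemma discounted_dividends_le (D : Omega -> cumulative R R) (T : \bar R)
    (delta h : R) (v : nat -> R) (K : R) :
  admissible E Y D -> (0 < delta)%R -> (0 < h)%R -> (forall j, 0 <= v j)%R ->
  (forall j t, (0 <= t)%R -> t%:E < T -> (t < j.+1%:R * h)%R -> (t <= v j)%R) ->
  (forall n, \sum_(j < n) (1 - expR (- (delta * h))) * expR (- (delta * h)) ^+ j * v j <= K)%R ->
  discounted_dividends P x rho delta T E Y D <=
  (x + m * (q + 1) + m * (lam + q) * K)%:E.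
Proof.
move=> [Dneg _] d0 h0 v0 vP vK; set r := expR (- (delta * h)) in vK *.
have r0 : (0 <= r)%R by exact: expR_ge0.
have r1 : (r < 1)%R by rewrite -expR0 ltr_expR oppr_lt0 mulr_gt0.
pose a j : R := ((1 - r) * r ^+ j)%R.
have a0 j : (0 <= a j)%R by rewrite mulr_ge0 ?exprn_ge0// subr_ge0 ltW.
have mrev s := measurable_revenue model s.
have xrev0 s w : 0 <= x%:E + revenue E Y s w by rewrite adde_ge0 ?lee_fin ?revenue_ge0.
have mt j : measurable_fun setT (fun w => (a j)%:E * (x%:E + revenue E Y (v j) w)).
  by apply: measurable_funeM; apply: emeasurable_funD.
have t0 j w : 0 <= (a j)%:E * (x%:E + revenue E Y (v j) w) by rewrite mule_ge0// lee_fin.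
apply: (@le_trans _ _ (\int[P]_w \sum_(j <oo) (a j)%:E * (x%:E + revenue E Y (v j) w))).
  apply: le_lower_integral_ae.
  - by move=> w; apply: integral_ge0 => t _; rewrite lee_fin expR_ge0.
  - by apply: ge0_emeasurable_sum => // j w _ _; exact: t0.
  - by move=> w; apply: nneseries_ge0 => j _ _; exact: t0.
  apply: filterS ae_nonneg_increments => w good.
  by apply: discounted_path_le => //; [move=> i; exact: (good i).1|exact: Dneg].
rewrite integral_nneseries//.
apply: lime_le; first by apply: is_cvg_nneseries => j _ _; exact: integral_ge0.
apply: nearW => n; rewrite big_mkord.
apply: (@le_trans _ _ (\sum_(j < n) (a j * (x + m * (lam * v j + (1 + v j) * q + 1)))%:E)).
  apply: lee_sum => j _.
  have mxrev : measurable_fun setT (fun w => x%:E + revenue E Y (v j) w).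
    exact: emeasurable_funD.
  have xrev0' w : setT w -> 0 <= x%:E + revenue E Y (v j) w by [].
  have aj0 : 0 <= (a j)%:E by rewrite lee_fin.
  rewrite (ge0_integralZl P measurableT mxrev xrev0' aj0) [leRHS]EFinM.
  by apply: lee_wpmul2l => //; exact: erev_shift.
rewrite sumEFin lee_fin.
have aE : (\sum_(j < n) a j = 1 - r ^+ n)%R.
  elim: n => [|n IH]; first by rewrite big_ord0 expr0 subrr.
  by rewrite big_ord_recr/= IH /a exprS; ring.
have -> : (\sum_(j < n) a j * (x + m * (lam * v j + (1 + v j) * q + 1)) =
  (\sum_(j < n) a j) * (x + m * (q + 1)) + m * (lam + q) * \sum_(j < n) a j * v j)%R.
  rewrite [X in (X + _)%R]mulr_suml mulr_sumr -big_split; apply: eq_bigr => j _ /=.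
  by ring.
rewrite aE lerD//.
  by rewrite ler_piMl ?gerBl ?exprn_ge0// addr_ge0// mulr_ge0// addr_ge0.
by rewrite ler_wpM2l// mulr_ge0// addr_ge0// ltW.
Qed.

Lemma value_function_le_infty (delta : R) : (0 < delta)%R ->
  value_function P x rho delta +oo E Y <=
  (x + m * (lam * (1 / delta) + (1 + 1 / delta) * q + 1))%:E.
Proof.
move=> d0; apply: ge_ereal_sup => _ [D adm <-].
(* Here [K = 1 / delta + h], so the excess over the limiting bound is [m * (lam + q) * h], and it
   vanishes with the mesh. *)
apply: (@le_ereal_of_harmonic _ _ _ (m * (lam + q))%R); first by rewrite mulr_ge0// addr_ge0// ltW.
move=> n; pose h : R := (n.+1%:R^-1)%R.
have h0 : (0 < h)%R by rewrite invr_gt0 ltr0n.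
apply: le_trans (discounted_dividends_le adm d0 h0 (v := fun j => (j.+1%:R * h)%R)
  (K := ((1 + delta * h) / delta)%R) _ _ _) _.
- by move=> j; rewrite mulr_ge0// ltW.
- by move=> j t _ _ /ltW.
- by move=> k; exact: geometric_mean_time_le_infty.
rewrite lee_fin -/h le_eqVlt; apply/orP; left; apply/eqP.
by field; rewrite gt_eqF.
Qed.

Lemma value_function_le_finite (delta T : R) : (0 < delta)%R -> (0 < T)%R ->
  value_function P x rho delta T%:E E Y <=
  (x + m * (lam * ((1 - expR (- (delta * T))) / delta) +
            (1 + (1 - expR (- (delta * T))) / delta) * q + 1))%:E.
Proof.
move=> d0 T0; apply: ge_ereal_sup => _ [D adm <-].
set kap := (1 - expR (- (delta * T)))%R.
have kap0 : (0 <= kap)%R.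
  by rewrite subr_ge0 -expR0 ler_expR oppr_le0 mulr_ge0// ltW.
apply: (@le_ereal_of_harmonic _ _ _ (m * (lam + q) * kap * T)%R).
  by rewrite mulr_ge0 ?(ltW T0)// mulr_ge0// mulr_ge0// addr_ge0// ltW.
move=> n; pose h : R := (T / n.+1%:R)%R.
have h0 : (0 < h)%R by rewrite divr_gt0// ltr0n.
have rT : (expR (- (delta * h)) ^+ n.+1 = expR (- (delta * T)))%R.
  rewrite -expRM_natl; congr expR; rewrite /h; field.
  by rewrite ?natr1 ?nat1r pnatr_eq0.
apply: le_trans (discounted_dividends_le adm d0 h0 (v := fun j => ((minn j.+1 n.+1)%:R * h)%R)
  (K := (kap * ((1 + delta * h) / delta))%R) _ _ _) _.
- by move=> j; rewrite mulr_ge0// ltW.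
- move=> j t _; rewrite lte_fin => tT tj; rewrite /minn; case: ifP => _; first exact: ltW.
  by rewrite /h mulrCA divff ?mulr1 ?pnatr_eq0// ltW.
- by move=> k; rewrite /kap -rT; exact: geometric_mean_time_le.
rewrite lee_fin le_eqVlt; apply/orP; left; apply/eqP; rewrite /h.
field; rewrite (gt_eqF d0)/=.
by rewrite ?natr1 ?nat1r pnatr_eq0.
Qed.

Lemma value_function_le_undiscounted (T : R) : (0 < T)%R ->
  value_function P x rho 0 T%:E E Y <=
  (x + m * (lam * T + (1 + T) * q + 1))%:E.
Proof.
move=> T0; apply: ge_ereal_sup => _ [D [Dneg _] <-].
apply: (@le_trans _ _ (\int[P]_w (x%:E + revenue E Y T w))); last first.
  by apply: erev_shift; exact: ltW.
apply: le_lower_integral_ae.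
- by move=> w; apply: integral_ge0 => t _; rewrite lee_fin expR_ge0.
- by apply: emeasurable_funD => //; exact: (measurable_revenue model).
- by move=> w; rewrite adde_ge0 ?lee_fin ?revenue_ge0.
apply: filterS ae_nonneg_increments => w good.
have Y0 i : (0 <= Y i w)%R := (good i).1.
have mD := @measurable_paid_before_ruin _ _ _ E Y w x rho D T%:E.
under eq_integral do rewrite mul0r oppr0 expR0.
rewrite integral_cst// mul1e.
apply: le_trans (@dividends_before_le _ _ _ E Y w Y0 x rho D x0 rho0 (Dneg w) T%:E T T _ _).
- apply: le_measure; rewrite ?inE//.
    apply: measurableI => //.
    rewrite (_ : [set t | _] = `]-oo, T[%classic); first exact: measurable_itv.
    by apply/seteqP; split => t /=; rewrite in_itv.
  by move=> t [t0 tm]; split => //; move: tm; rewrite lt_min => /andP[]; rewrite lte_fin.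
- exact: ltW.
- by move=> t _ _ /ltW.
Qed.

End value_upper.

(** * Lower bound *)

Section grid_strategy.
Context {R : realType} {d : measure_display} {Omega : measurableType d}.
Variables (E Y : nat -> Omega -> R) (n : nat) (h c : R).
Hypothesis h0 : 0 <= h.

(** A running maximum is nondecreasing on every path, even on the null set where [jump_process]
    decreases or is infinite and [fine] returns 0. It uses only values already observed at time
    [t]. *)
Definition grid_dividend (w : Omega) (t : R) : R :=
  \big[Num.max/0]_(j < n | j.+1%:R * h <= t)
    (fine (jump_process E Y (j.+1%:R * h) w) - c).

Lemma grid_dividend_ge0 w t : 0 <= grid_dividend w t.
Proof. exact: bigmax_ge_id. Qed.

Lemma grid_dividend_nd w : nondecreasing (grid_dividend w).
Proof.
move=> s t st; apply: bigmax_le; first exact: grid_dividend_ge0.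
move=> j js; apply: (@le_bigmax_cond _ _ _ _ j); exact: le_trans st.
Qed.

Lemma grid_dividend_right_continuous w :
  forall t, grid_dividend w @ at_right t --> grid_dividend w t.
Proof.
move=> t; apply: cvg_near_cst.
have : \forall y \near t^'+, forall j : 'I_n, (j.+1%:R * h <= y) = (j.+1%:R * h <= t).
  apply: filter_forall => j; have [jt|tj] := leP (j.+1%:R * h) t.
    near=> y; apply: (le_trans jt); apply: ltW; near: y; exact: nbhs_right_gt.
  near=> y; apply/negbTE; rewrite -ltNge; near: y; exact: nbhs_right_lt.
apply: filterS => y jy; rewrite /grid_dividend; apply: eq_bigl => j; exact: jy.
Unshelve. all: by end_near. Qed.

Definition grid_strategy (w : Omega) : cumulative R R :=
  HB.pack (grid_dividend w) (isCumulative.Build R _ R (grid_dividend w)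
    (@grid_dividend_nd w) (@grid_dividend_right_continuous w)).

Lemma grid_strategyE w t : grid_strategy w t = grid_dividend w t.
Proof. by []. Qed.

Lemma admissible_grid_strategy : admissible E Y grid_strategy.
Proof.
split=> [w t t0|t t0 B mB].
  rewrite grid_strategyE /grid_dividend big_pred0// => j.
  by apply/negbTE; rewrite -ltNge (lt_le_trans t0)// mulr_ge0.
pose G := [set A | exists s : R, exists B : set (\bar R),
         [/\ 0 <= s, s <= t, measurable B & A = jump_process E Y s @^-1` B]].
(* On [Omega] equipped with the past of the jump process up to [t], adaptedness is ordinary
   measurability of a finite maximum. *)
pose O := g_sigma_algebraType G.
have mJ s : 0 <= s -> s <= t -> measurable_fun (setT : set O) (jump_process E Y s).
  move=> s0 st _ C mC; rewrite setTI; apply: sub_sigma_algebra.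
  by exists s, C.
have mD : measurable_fun (setT : set O) (fun w => grid_dividend w t).
  rewrite /grid_dividend; elim: (index_enum _) => [|j r IH].
    by under eq_fun do rewrite big_nil; exact: measurable_cst.
  under eq_fun do rewrite big_cons; have [jt|_] := boolP (j.+1%:R * h <= t); last exact: IH.
  apply: measurable_maxr => //; apply: measurable_funB => //.
  apply: (@measurableT_comp _ _ _ _ _ _ fine) => //.
  by apply: mJ => //; exact: mulr_ge0.
have := mD measurableT B mB; rewrite setTI; exact.
Qed.

End grid_strategy.

Section stieltjes_cells.
Context {R : realType}.
Variables (f : cumulative R R) (delta : R) (u : nat -> R).
Hypothesis delta0 : 0 <= delta.
Hypothesis u_nd : forall j, u j <= u j.+1.
Local Open Scope ereal_scope.

(** Each cell is discounted from its right end, where the exponential is smallest. *)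
Lemma stieltjes_discounted_ge (n : nat) (S : set R) : measurable S ->
  (forall t, (u 0%N < t)%R -> (t <= u n)%R -> S t) ->
  (\sum_(j < n) expR (- (delta * u j.+1)) * (f (u j.+1) - f (u j)))%:E <=
  \int[lebesgue_stieltjes_measure f]_(t in S) (expR (- (delta * t)))%:E.
Proof.
move=> mS sub.
have mexp (D : set R) : measurable_fun D (fun t : R => (expR (- (delta * t)))%:E).
  apply/measurable_EFinP; apply: measurable_funTS; apply: measurableT_comp => //.
  by apply: measurableT_comp => //; exact: mulrl_measurable.
have u0n k : (u 0%N <= u k)%R by elim: k => // k IH; exact: le_trans IH (u_nd k).
apply: (@le_trans _ _ (\int[lebesgue_stieltjes_measure f]_(t in `]u 0%N, u n])
    (expR (- (delta * t)))%:E)); last first.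
  apply: ge0_subset_integral => //.
  - exact: mexp.
  - by move=> t; rewrite /= in_itv/= => /andP[]; exact: sub.
elim: {mS sub} n => [|n IH].
  by rewrite big_ord0; apply: integral_ge0 => t _; rewrite lee_fin expR_ge0.
have -> : `]u 0%N, u n.+1]%classic = `]u 0%N, u n] `|` `]u n, u n.+1].
  apply/seteqP; split => t /=; rewrite !in_itv/=.
    by move=> /andP[-> tn]; have [_|tn'] := leP t (u n); [left|right].
  case=> /andP[t1 t2]; first by rewrite t1 (le_trans t2).
  by rewrite t2 andbT (le_lt_trans (u0n n)).
rewrite ge0_integral_setU//; last 2 first.
- exact: mexp.
- by apply/disj_setPS => t [] /=; rewrite !in_itv/= => /andP[_ tn] /andP[]; rewrite ltNge tn.
rewrite big_ord_recr/= EFinD leeD//.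
rewrite EFinM -lebesgue_stieltjes_itv// -integral_cst; last exact: measurable_itv.
apply: le_lower_integral => t; rewrite /= in_itv/= => /andP[_ tu].
  by rewrite lee_fin expR_ge0.
by rewrite lee_fin ler_expR lerN2 ler_wpM2l.
Qed.

(** Summation by parts trades increments of [F], for which no lower bound is at hand, for its
    values, weighted by differences of discount factors. The boundary weight is taken at [u n.+1]
    instead of [u n], which makes the summand uniform in [j]. *)
Lemma abel_discounted (F : nat -> R) (n : nat) : F 0%N = 0%R ->
  (\sum_(j < n) expR (- (delta * u j.+1)) * (F j.+1 - F j) =
   \sum_(j < n) (expR (- (delta * u j.+1)) - expR (- (delta * u j.+2))) * F j.+1 +
   expR (- (delta * u n.+1)) * F n)%R.
Proof.
move=> F0; elim: n => [|n IH]; first by rewrite !big_ord0 F0 mulr0 addr0.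
by rewrite !big_ord_recr/= IH; ring.
Qed.

End stieltjes_cells.

Section pathwise_lower.
Context {R : realType} {d : measure_display} {Omega : measurableType d}.
Variables (E Y : nat -> Omega -> R) (w : Omega).
Hypothesis good : forall i, 0 <= Y i w /\ 0 <= E i w.
Let Y0 i : 0 <= Y i w := (good i).1.
Variables (x rho T delta eps : R) (N k : nat).
Hypotheses (rho0 : 0 <= rho) (T0 : 0 < T) (delta0 : 0 <= delta).
(** There are [N + 2] cells but only [N + 1] payment dates, so the last payment falls strictly
    before [T], as the right-open integration set requires. *)
Let h := T / N.+2%:R.
Let c := rho * T.
Hypotheses (eps0 : 0 <= eps) (epsx : rho * eps < x).
Hypothesis quick : quick_start E Y k eps c w.
Hypothesis fin : (revenue E Y (N.+1%:R * h) w < +oo)%E.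
Let D := grid_strategy E Y N.+1 h c.
Local Open Scope ereal_scope.

Let h0 : (0 < h)%R. Proof. by rewrite divr_gt0// ltr0n. Qed.

Let c0 : (0 <= c)%R. Proof. by rewrite mulr_ge0// ltW. Qed.

Lemma quick_start_revenue : c%:E <= revenue E Y eps w.
Proof.
case: quick => arr cY.
apply: (@le_trans _ _ (\sum_(j < k.+1) Y j w)%R%:E); first by rewrite lee_fin.
rewrite -sumEFin -(big_mkord xpredT (fun j => (Y j w)%:E)).
apply: (@le_trans _ _ (\sum_(0 <= j < k.+1)
    (Num.max (Y j w) 0 * (arrival E j w <= eps)%R%:R)%:E)); last first.
  by apply: nneseries_lim_ge => i _; rewrite lee_fin mulr_ge0// le_max lexx orbT.
rewrite !big_mkord; apply: lee_sum => j _.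
rewrite lee_fin max_l// (_ : (arrival E j w <= eps)%R) ?mulr1//.
apply: le_trans arr; rewrite /arrival.
rewrite -(big_mkord xpredT (fun i => E i w)) -(big_mkord xpredT (fun i => E i w)).
rewrite (big_cat_nat (leq0n j.+1) (ltn_ord j))/= lerDl.
by apply: sumr_ge0 => i _; exact: (good i).2.
Qed.

Let rev_fin j : (j <= N)%N -> revenue E Y (j.+1%:R * h) w \is a fin_num.
Proof.
move=> jN; rewrite ge0_fin_numE ?revenue_ge0//; apply: le_lt_trans fin.
apply: revenue_nd => //; rewrite ler_pM2r// ler_nat; exact: jN.
Qed.

(** With [r] the revenue at [t], dividends never exceed [Num.max 0 (r - c)]. Up to [eps] they are at
    most [r], and the cost is below [x]. After [eps] the quick start gives [c <= r], so at least [c]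
    is retained, which covers the cost [rho * t]. *)
Lemma no_ruin_before : T%:E <= ruin_time x rho E Y D w.
Proof.
apply: le_ereal_inf_tmp => _ [t [t0 surp] <-]; rewrite lee_fin leNgt; apply/negP => tT.
move: surp; apply/negP; rewrite -ltNge /surplus jump_processE//.
have := revenue_ge0 E Y t w; have := @revenue_nd _ _ _ E Y w eps t.
case Jt: (revenue E Y t w) => [r| |//] epst; last by rewrite addey// ltry.
rewrite lee_fin -EFinD lte_fin => r0.
have Dle : (D w t <= Num.max 0 (r - c))%R.
  rewrite /D grid_strategyE; apply: bigmax_le; first by rewrite le_max lexx.
  move=> j jt; rewrite le_max lerD2r; apply/orP; right.
  rewrite -lee_fin jump_processE// fineK; first by rewrite -Jt revenue_nd.
  by apply: rev_fin; rewrite -ltnS.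
have rt : (rho * t <= c)%R by rewrite ler_wpM2l// ltW.
have [te|te] := leP t eps.
  have : (rho * t <= rho * eps)%R by rewrite ler_wpM2l.
  have c0' := c0.
  move: Dle epsx c0' r0; rewrite maxEle; move: (D w t) c => Dt c' {rt}.
  by case: ifP => _; lra.
have cr : (c <= r)%R.
  by rewrite -lee_fin -Jt (le_trans quick_start_revenue)// revenue_nd// ltW.
have : (rho * eps < x)%R by [].
have : (0 <= rho * eps)%R by rewrite mulr_ge0.
move: Dle rt; rewrite max_r ?subr_ge0//; move: (D w t) c => Dt c'; lra.
Qed.

(** At each payment date the dividends are at least the revenue minus [c]. The weights left by
    summation by parts are nonnegative with total at most 1, so [c] is lost at most once. *)
Lemma discounted_path_ge :
  \sum_(j < N.+1) (expR (- (delta * (j.+1%:R * h))) - expR (- (delta * (j.+2%:R * h))))%:E *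
     revenue E Y (j.+1%:R * h) w +
  (expR (- (delta * (N.+2%:R * h))))%:E * revenue E Y (N.+1%:R * h) w <=
  \int[lebesgue_stieltjes_measure (D w)]_(t in
     [set t : R | (0 <= t)%R /\ t%:E < Order.min T%:E (ruin_time x rho E Y D w)])
     (expR (- (delta * t)))%:E + c%:E.
Proof.
pose u (j : nat) : R := (j%:R * h)%R.
have u_nd j : (u j <= u j.+1)%R by rewrite /u ler_pM2r// ler_nat.
have uNT : (u N.+1 < T)%R.
  rewrite /u /h mulrA ltr_pdivrMr ?ltr0n// mulrC ltr_pM2l//.
  by rewrite ltr_nat.
set S := [set t : R | _ /\ _].
have mS : measurable S by exact: (@measurable_paid_before_ruin _ _ _ E Y w x rho D T%:E).
have sub t : (u 0%N < t)%R -> (t <= u N.+1)%R -> S t.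
  rewrite /u mul0r => t0 tu; split; first exact: ltW.
  by rewrite (min_l no_ruin_before) lte_fin (le_lt_trans tu).
have key := @stieltjes_discounted_ge _ (D w) delta u delta0 u_nd N.+1 S mS sub.
apply: (le_trans _ (leeD key (lexx c%:E))).
have D0 : D w (u 0%N) = 0%R.
  rewrite /D grid_strategyE /grid_dividend big_pred0// => j.
  by apply/negbTE; rewrite -ltNge /u mul0r mulr_gt0// ltr0n.
pose rj j := fine (revenue E Y (u j) w).
have rE j : (j <= N)%N -> revenue E Y (j.+1%:R * h) w = (rj j.+1)%:E.
  by move=> jN; rewrite fineK//; exact: rev_fin.
have Dge j : (j <= N)%N -> (rj j.+1 - c <= D w (u j.+1))%R.
  move=> jN; rewrite /D grid_strategyE /rj -jump_processE//.
  have jN' : (j < N.+1)%N by rewrite ltnS.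
  exact: (@le_bigmax_cond _ _ _ _ (Ordinal jN')).
rewrite (abel_discounted delta u (F := fun j => D w (u j)) N.+1 D0).
rewrite rE// -EFinM (eq_bigr (fun j : 'I_N.+1 =>
  ((expR (- (delta * u j.+1)) - expR (- (delta * u j.+2))) * rj j.+1)%:E)); last first.
  by move=> j _; have jN : (j <= N)%N := ltn_ord j; rewrite rE.
rewrite sumEFin -!EFinD lee_fin -/(u N.+2).
have e_nd j : (0 <= expR (- (delta * u j.+1)) - expR (- (delta * u j.+2)))%R.
  by rewrite subr_ge0 ler_expR lerN2 ler_wpM2l.
have e1 : (\sum_(j < N.+1) (expR (- (delta * u j.+1)) - expR (- (delta * u j.+2))) +
    expR (- (delta * u N.+2)) = expR (- (delta * u 1%N)))%R.
  elim: (N.+1) => [|n IH]; first by rewrite big_ord0 add0r.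
  by rewrite big_ord_recr/= -IH; ring.
have e1c : (c * expR (- (delta * u 1%N)) <= c)%R.
  rewrite ler_piMr// -expR0 ler_expR oppr_le0 mulr_ge0//.
  by rewrite /u mulr_ge0// ltW.
rewrite -lerBlDr; apply: (@le_trans _ _ (\sum_(j < N.+1)
   (expR (- (delta * u j.+1)) - expR (- (delta * u j.+2))) * (rj j.+1 - c) +
   expR (- (delta * u N.+2)) * (rj N.+1 - c))%R); last first.
  apply: lerD; last by rewrite ler_wpM2l ?expR_ge0// Dge.
  by apply: ler_sum => j _; rewrite ler_wpM2l// Dge// -ltnS.
under [X in (_ <= X + _)%R]eq_bigr do rewrite mulrBr.
rewrite sumrB -mulr_suml; move: e1c; rewrite -e1; lra.
Qed.

End pathwise_lower.

(** Dual device: the measurable minorant is set to 0 on the null set. *)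
Lemma ge_lower_integral_ae {d} {T : measurableType d} {R : realType}
    (mu : {measure set T -> \bar R}) (f g : T -> \bar R) :
  (forall x, 0 <= f x)%E -> measurable_fun setT g -> (forall x, 0 <= g x)%E ->
  {ae mu, forall x, (g x <= f x)%E} ->
  (\int[mu]_x g x <= \int[mu]_x f x)%E.
Proof.
move=> f0 mg g0 [N [mN N0 sub]].
rewrite (_ : \int[mu]_x g x = \int[mu]_x (g \_ (~` N)) x)%E; last first.
  apply: ge0_ae_eq_integral => //.
  - by apply/(measurable_restrictT _ _).1; [exact: measurableC|exact: measurable_funTS].
  - by move=> x _; exact: erestrict_ge0.
  exists N; split => // x /= /not_implyP[_].
  by apply: contra_notP => xN; rewrite patchE mem_set.
apply: le_lower_integral => x _; first exact: erestrict_ge0.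
rewrite patchE; case: ifPn => // /set_mem xN.
by apply: contrapT => gf; apply: xN; exact: sub.
Qed.

Section value_lower.
Context {R : realType} {d : measure_display} {Omega : measurableType d}.
Variables (P : probability Omega R) (lam : R) (p : R -> R) (E Y : nat -> Omega -> R).
Hypothesis lam1 : 1 < lam.
Hypothesis p0 : forall y, 0 < y -> 0 <= p y.
Local Notation mu := lebesgue_measure.
Local Notation pos := [set y : R | (0 < y)%R].
Hypothesis p1 : (\int[mu]_(y in pos) (p y)%:E = 1)%E.
Hypothesis model : compound_poisson_model P lam p E Y.
Hypothesis mean_fin : (mean_jump p < +oo)%E.
Variables (x rho delta T eps C : R) (N k : nat).
Hypotheses (rho0 : 0 <= rho) (T0 : 0 < T) (delta0 : 0 <= delta).
Let h := T / N.+2%:R.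
Hypotheses (eps0 : 0 <= eps) (epsx : rho * eps < x).
Local Notation m := (fine (mean_jump p)).
Local Notation q := (Num.sqrt lam).
(** A Chernoff bound for the failure of the quick start: the first term covers a late arrival of
    index [k], the second a partial sum of jumps below [rho * T]. *)
Let G := expR (- (lam / 2 * eps)) * 2 ^+ k.+1 +
  expR (rho * T) * fine (laplace_jump P Y) ^+ k.+1.
Hypothesis G1 : G <= 1.
Hypothesis Ch : C - h <= h * \sum_(j < N.+1) expR (- (delta * h)) ^+ j.+1.
Local Open Scope ereal_scope.

Let lam0 : (0 < lam)%R. Proof. exact: lt_trans lam1. Qed.
Let h0 : (0 < h)%R. Proof. by rewrite divr_gt0// ltr0n. Qed.

Lemma value_function_ge :
  (m * (lam * (1 - G) * (C - h) - (1 + T) * q - k%:R - 2) - rho * T)%:E <=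
  value_function P x rho delta T%:E E Y.
Proof.
pose A := quick_start E Y k eps (rho * T).
have mA : measurable A := measurable_quick_start model _ _ _.
have m0 : (0 <= m)%R by rewrite fine_ge0// ltW//; exact: (mean_jump_gt0 p0 p1 model).
pose u (j : nat) : R := (j%:R * h)%R.
have u0 j : (0 <= u j)%R by rewrite /u mulr_ge0// ltW.
pose e (j : nat) : R := expR (- (delta * u j)).
have e0 j : (0 <= e j)%R by exact: expR_ge0.
pose b j : R := (e j.+1 - e j.+2)%R.
have b0 j : (0 <= b j)%R.
  rewrite /b subr_ge0 ler_expR lerN2 ler_wpM2l// /u ler_pM2r// ler_nat.
  exact: leqnSn.
pose W w := \sum_(j < N.+1) (b j)%:E * revenue E Y (u j.+1) w +
  (e N.+2)%:E * revenue E Y (u N.+1) w.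
have mrev s := measurable_revenue model s.
pose F w := W w * (\1_A w)%:E.
have mI : measurable_fun setT (fun w => (\1_A w)%:E : \bar R).
  by apply/measurable_EFinP; exact: measurable_indic.
have trm j (a : R) : (0 <= a)%R ->
  \int[P]_w (a%:E * (revenue E Y (u j) w * (\1_A w)%:E)) =
  a%:E * \int[P]_w (revenue E Y (u j) w * (\1_A w)%:E).
  move=> a0; apply: ge0_integralZl => //; first exact: emeasurable_funM.
  by move=> w _; rewrite mule_ge0 ?revenue_ge0// lee_fin.
have FE w : F w = \sum_(j < N.+1) (b j)%:E * (revenue E Y (u j.+1) w * (\1_A w)%:E) +
    (e N.+2)%:E * (revenue E Y (u N.+1) w * (\1_A w)%:E).
  rewrite /F /W ge0_muleDl; last 2 first.
  - by apply: sume_ge0 => j _; rewrite mule_ge0 ?revenue_ge0// lee_fin.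
  - by rewrite mule_ge0 ?revenue_ge0// lee_fin.
  rewrite ge0_sume_distrl; last first.
    by move=> j _; rewrite mule_ge0 ?revenue_ge0// lee_fin.
  by rewrite -!muleA; congr (_ + _); apply: eq_bigr => j _; rewrite muleA.
have mt j (a : R) : measurable_fun setT (fun w => a%:E * (revenue E Y (u j) w * (\1_A w)%:E)).
  by apply: measurable_funeM; exact: emeasurable_funM.
have t0 j (a : R) w : (0 <= a)%R -> 0 <= a%:E * (revenue E Y (u j) w * (\1_A w)%:E).
  by move=> a0; rewrite !mule_ge0 ?revenue_ge0// lee_fin.
have F0 w : 0 <= F w.
  by rewrite FE adde_ge0 ?t0// sume_ge0// => j _; exact: t0.
have mF : measurable_fun setT F.
  rewrite (_ : F = fun w => \sum_(j < N.+1) (b j)%:E * (revenue E Y (u j.+1) w * (\1_A w)%:E) +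
    (e N.+2)%:E * (revenue E Y (u N.+1) w * (\1_A w)%:E)); last exact/funext.
  by apply: emeasurable_funD => //; exact: emeasurable_sum.
pose L s : R := (m * (lam * s * (1 - G) - (1 + s) * q - k%:R - 2))%R.
have Lle j : (L (u j))%:E <= \int[P]_w (revenue E Y (u j) w * (\1_A w)%:E).
  exact: (expectation_revenue_ge lam0 p0 p1 model mean_fin eps (rho * T) k lam1 (u0 j)).
have IF : (\sum_(j < N.+1) b j * L (u j.+1) + e N.+2 * L (u N.+1))%:E <= \int[P]_w F w.
  under eq_integral do rewrite FE.
  rewrite ge0_integralD//; last 3 first.
  - by move=> w _; apply: sume_ge0 => j _; exact: t0.
  - exact: emeasurable_sum.
  - by move=> w _; exact: t0.
  rewrite ge0_integral_sum//; last by move=> j w _; exact: t0.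
  rewrite EFinD -sumEFin trm//; apply: leeD.
    by apply: lee_sum => j _; rewrite trm// EFinM lee_wpmul2l// lee_fin.
  by rewrite EFinM lee_wpmul2l// lee_fin.
have uT j : (j <= N.+1)%N -> (u j <= T)%R.
  move=> jN; rewrite /u /h mulrA ler_pdivrMr ?ltr0n// mulrC ler_pM2l//.
  by rewrite ler_nat (leq_trans jN).
have c0 : (0 <= rho * T)%R by rewrite mulr_ge0// ltW.
have LW : (m * (lam * (1 - G) * (C - h) - (1 + T) * q - k%:R - 2) <=
    \sum_(j < N.+1) b j * L (u j.+1) + e N.+2 * L (u N.+1))%R.
  (* Bounding every grid time by [T] in the error term makes it a constant. Summation by parts, read
     backwards on the remaining linear term, recovers the Riemann sum bounded in [Ch]. *)
  pose kap : R := ((1 + T) * q + k%:R + 2)%R.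
  have q0 : (0 <= q)%R by exact: sqrtr_ge0.
  have kap0 : (0 <= kap)%R by rewrite !addr_ge0// mulr_ge0// addr_ge0// ltW.
  pose K j : R := (m * (lam * (1 - G) * u j - kap))%R.
  have KL j : (j <= N.+1)%N -> (K j <= L (u j))%R.
    move=> jN; rewrite /K /L ler_wpM2l// /kap.
    have : ((1 + u j) * q <= (1 + T) * q)%R by rewrite ler_wpM2r// lerD2l uT.
    lra.
  apply: (@le_trans _ _ (\sum_(j < N.+1) b j * K j.+1 + e N.+2 * K N.+1)%R); last first.
    apply: lerD; last by rewrite ler_wpM2l// KL.
    by apply: ler_sum => j _; rewrite ler_wpM2l// KL.
  have abelu : (\sum_(j < N.+1) b j * u j.+1 + e N.+2 * u N.+1 =
      h * \sum_(j < N.+1) expR (- (delta * h)) ^+ j.+1)%R.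
    rewrite -(@abel_discounted _ delta u u N.+1); last by rewrite /u mul0r.
    rewrite mulr_sumr; apply: eq_bigr => j _.
    rewrite -expRM_natl /u mulrN mulrCA mulrC; congr (_ * _)%R.
    by rewrite -natr1; ring.
  have abel1 : (\sum_(j < N.+1) b j + e N.+2 = e 1%N)%R.
    elim: (N.+1) => [|n IH]; first by rewrite big_ord0 add0r.
    by rewrite big_ord_recr/= -IH /b; ring.
  have e1 : (e 1%N <= 1)%R.
    by rewrite /e -expR0 ler_expR oppr_le0 mulr_ge0.
  have -> : (\sum_(j < N.+1) b j * K j.+1 + e N.+2 * K N.+1 =
      m * (lam * (1 - G) * (\sum_(j < N.+1) b j * u j.+1 + e N.+2 * u N.+1) -
           kap * (\sum_(j < N.+1) b j + e N.+2)))%R.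
    rewrite (eq_bigr (fun j : 'I_N.+1 => m * (lam * (1 - G)) * (b j * u j.+1) - m * kap * b j)%R); last first.
      by move=> j _; rewrite /K; ring.
    by rewrite sumrB -!mulr_sumr /K; ring.
  rewrite abelu abel1 ler_wpM2l//.
  have H1 : (lam * (1 - G) * (C - h) <= lam * (1 - G) * (h * \sum_(j < N.+1) expR (- (delta * h)) ^+ j.+1))%R.
    by rewrite ler_wpM2l// mulr_ge0 ?subr_ge0// ltW.
  have H2 : (kap * e 1%N <= kap * 1)%R by rewrite ler_wpM2l.
  move: H1 H2; rewrite /kap; lra.
pose D := grid_strategy E Y N.+1 h (rho * T).
apply: (@le_trans _ _ (discounted_dividends P x rho delta T%:E E Y D)); last first.
  apply: ereal_sup_ubound; exists D => //.
  by apply: admissible_grid_strategy; exact: ltW.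
rewrite EFinB leeBlDr//; apply: (@le_trans _ _ (\int[P]_w F w)).
  by apply: le_trans IF; rewrite lee_fin.
(* [F - rho * T] may be negative, in particular off [A], where [F] vanishes. The positive part is
   still below the payout, and adding [rho * T] back recovers at least [F]. *)
pose g w := maxe (F w - (rho * T)%:E) 0.
have mg : measurable_fun setT g.
  by apply: measurable_maxe => //; apply: emeasurable_funB.
have g0 w : 0 <= g w by rewrite le_max lexx orbT.
apply: (@le_trans _ _ (\int[P]_w (g w + (rho * T)%:E))).
  apply: ge0_le_integral => //.
  - exact: emeasurable_funD.
  - by move=> w _; rewrite -leeBlDr// le_max lexx.
rewrite ge0_integralD//.
have -> : \int[P]_w (rho * T)%:E = (rho * T)%:E.
  rewrite (integral_cst P measurableT) -[RHS]mule1.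
  by congr (_ * _); exact: probability_setT.
apply: leeD => //; apply: ge_lower_integral_ae => //.
  by move=> w; apply: integral_ge0 => t _; rewrite lee_fin expR_ge0.
have rev_int : P.-integrable setT (revenue E Y (u N.+1)).
  apply/integrableP; split => //.
  have -> : \int[P]_w `|revenue E Y (u N.+1) w| = \int[P]_w revenue E Y (u N.+1) w.
    by apply: eq_integral => w _; rewrite gee0_abs ?revenue_ge0.
  apply: le_lt_trans (expectation_revenue_le lam0 p0 p1 model (u0 N.+1)) _.
  rewrite -(@fineK _ (mean_jump p)) -?EFinM ?ltry//.
  rewrite ge0_fin_numE// ltW//; exact: (mean_jump_gt0 p0 p1 model).
have ae1 := integrable_ae measurableT rev_int.
have ae2 := ae_nonneg_increments lam0 model.
apply: filterS2 ae1 ae2 => w rfin good.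
rewrite ge_max; apply/andP; split; last first.
  by apply: integral_ge0 => t _; rewrite lee_fin expR_ge0.
rewrite leeBlDr// /F indicE; have [wA|wA] := boolP (w \in A); last first.
  rewrite mule0 adde_ge0 ?lee_fin//.
  by apply: integral_ge0 => t _; rewrite lee_fin expR_ge0.
rewrite mule1; apply: (@discounted_path_ge _ _ _ E Y w good x rho T delta eps N k) => //.
- exact: set_mem.
- by have := rfin I; rewrite ge0_fin_numE ?revenue_ge0.
Qed.

End value_lower.

(** * Limits *)

Section ratio_limits.
Context {R : realType}.

Lemma near_sqrt_le (K eta : R) : 0 < eta ->
  \forall lam \near +oo%R, K * Num.sqrt lam <= eta * lam.
Proof.
move=> e0; near=> lam.
have l0 : 0 < lam by near: lam; exact: nbhs_pinfty_gt.
have Kl : (`|K| / eta) ^+ 2 <= lam by near: lam; apply: nbhs_pinfty_ge; exact: num_real.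
have sK : `|K| / eta <= Num.sqrt lam.
  by rewrite -[leLHS]ger0_norm ?divr_ge0 ?(ltW e0)// -sqrtr_sqr ler_sqrt// ltW.
have s0 : 0 <= Num.sqrt lam by exact: sqrtr_ge0.
rewrite -{2}[lam]sqr_sqrtr ?(ltW l0)// expr2 mulrA; apply: ler_wpM2r => //.
by rewrite (le_trans (ler_norm _))// mulrC -ler_pdivrMr.
Unshelve. all: by end_near. Qed.

Lemma cvg_ratio1 (V : R -> \bar R) (g : R -> R) (M : R) :
  (forall lam, g lam = lam * M) -> 0 < M ->
  (forall eta, 0 < eta -> \forall lam \near +oo%R, (V lam <= (lam * (M + eta))%:E)%E) ->
  (forall eta, 0 < eta -> \forall lam \near +oo%R, ((lam * (M - eta))%:E <= V lam)%E) ->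
  (V lam * ((g lam)^-1)%:E)%E @[lam --> +oo%R] --> 1%E.
Proof.
move=> wE M0 up lo; apply/fine_cvgP; split.
  near=> lam.
  have l0 : 0 < lam by near: lam; exact: nbhs_pinfty_gt.
  have Vup : (V lam <= (lam * (M + 1))%:E)%E by near: lam; exact: up.
  have Vlo : ((lam * (M - 1))%:E <= V lam)%E by near: lam; exact: lo.
  rewrite fin_numM//; rewrite fin_numElt.
  by rewrite (lt_le_trans _ Vlo) ?ltNyr// (le_lt_trans Vup)// ltry.
apply/cvgrPdist_le => e e0; have eM : 0 < e * M by rewrite mulr_gt0.
near=> lam; have l0 : 0 < lam by near: lam; exact: nbhs_pinfty_gt.
have Vup : (V lam <= (lam * (M + e * M))%:E)%E by near: lam; exact: up.
have Vlo : ((lam * (M - e * M))%:E <= V lam)%E by near: lam; exact: lo.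
have lM : 0 < lam * M by rewrite mulr_gt0.
rewrite /= wE; move: Vup Vlo; case: (V lam) => [v| |] //=; rewrite !lee_fin => Vup Vlo.
rewrite (_ : 1 - v * (lam * M)^-1 = (lam * M - v) * (lam * M)^-1); last first.
  by rewrite mulrBl divff ?lt0r_neq0.
rewrite normrM [X in _ * X]gtr0_norm ?invr_gt0//.
rewrite ler_pdivrMr// ler_norml; apply/andP; split; lra.
Unshelve. all: by end_near. Qed.

Lemma near_upper (V : R -> \bar R) (x m C : R) : 0 <= x -> 0 <= m ->
  (forall lam, 0 < lam -> (V lam <= (x + m * (lam * C + (1 + C) * Num.sqrt lam + 1))%:E)%E) ->
  forall eta, 0 < eta -> \forall lam \near +oo%R, (V lam <= (lam * (m * C + eta))%:E)%E.
Proof.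
move=> x0 m0 H eta e0; near=> lam.
have l1 : 1 <= lam by near: lam; exact: nbhs_pinfty_ge.
have l0 : 0 < lam by rewrite (lt_le_trans _ l1).
apply: (le_trans (H _ l0)); rewrite lee_fin.
have K : (x + m + m * (1 + C)) * Num.sqrt lam <= eta * lam.
  by near: lam; exact: near_sqrt_le.
have s1 : 1 <= Num.sqrt lam by rewrite -[leLHS]sqrtr1 ler_sqrt.
have : (x + m) * 1 <= (x + m) * Num.sqrt lam by rewrite ler_wpM2l// addr_ge0.
by move: K; lra.
Unshelve. all: by end_near. Qed.

End ratio_limits.

(** Lets the infinite horizon inherit the lower bounds obtained for finite [T]. *)
Lemma value_function_le_horizon {R : realType} {d : measure_display}
    {Omega : measurableType d} (P : probability Omega R) (x rho delta T : R)
    (E Y : nat -> Omega -> R) :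
  (value_function P x rho delta T%:E E Y <=
   value_function P x rho delta +oo E Y)%E.
Proof.
apply: ge_ereal_sup => _ [D adm <-].
apply: (@le_trans _ _ (discounted_dividends P x rho delta +oo E Y D)).
  apply: le_lower_integral => w _.
    by apply: integral_ge0 => t _; rewrite lee_fin expR_ge0.
  apply: ge0_subset_integral.
  - exact: (@measurable_paid_before_ruin _ _ _ E Y w x rho D T%:E).
  - exact: (@measurable_paid_before_ruin _ _ _ E Y w x rho D +oo%E).
  - apply/measurable_EFinP; apply: measurable_funTS; apply: measurableT_comp => //.
    by apply: measurableT_comp => //; exact: mulrl_measurable.
  - by move=> t _; rewrite lee_fin expR_ge0.
  - move=> t [t0]; rewrite lt_min => /andP[_ ttau]; split => //.
    by rewrite lt_min ltry.
by apply: ereal_sup_ubound; exists D.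
Qed.

(** The sum is geometric with ratio [r], and [1 - r <= delta * h] is used twice: to replace [1 - r]
    by [delta * h], and to restore the missing first term at a cost of [h]. *)
Lemma discount_sum_ge {R : realType} (delta T : R) (N : nat) (h := T / N.+2%:R) : 0 < delta -> 0 < T ->
  (1 - expR (- (delta * T))) / delta - h <=
  h * \sum_(j < N.+1) expR (- (delta * h)) ^+ j.+1.
Proof.
move=> d0 T0; set r := expR (- (delta * h)).
have h0 : 0 < h by rewrite divr_gt0// ltr0n.
have sumE n : (1 - r) * \sum_(j < n) r ^+ j.+1 = r - r ^+ n.+1.
  elim: n => [|n IH]; first by rewrite big_ord0 mulr0 expr1 subrr.
  by rewrite big_ord_recr/= mulrDr IH !exprS; ring.
have rT : r ^+ N.+2 = expR (- (delta * T)).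
  rewrite /r -expRM_natl; congr expR; rewrite /h; field.
  by rewrite ?natr1 ?nat1r -?natrD pnatr_eq0.
have r1 : 1 - delta * h <= r by exact: expR_ge1Dx.
have S0 : 0 <= \sum_(j < N.+1) r ^+ j.+1 by apply: sumr_ge0 => j _; rewrite exprn_ge0// expR_ge0.
rewrite -(ler_pM2l d0) mulrBr mulrCA divff ?gt_eqF// mulr1 -rT.
have := sumE N.+1.
have : (1 - r) * \sum_(j < N.+1) r ^+ j.+1 <= delta * h * \sum_(j < N.+1) r ^+ j.+1.
  by apply: ler_wpM2r => //; lra.
lra.
Qed.

Unset Implicit Arguments.

Section asymptotics.
Variables (R : realType) (rho x : R) (p : R -> R)
  (d : R -> measure_display) (Omega : forall lam : R, measurableType (d lam))
  (P : forall lam : R, probability (Omega lam) R)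
  (E Y : forall lam : R, nat -> Omega lam -> R).
Local Notation mu := lebesgue_measure.
Local Notation pos := [set y : R | (0 < y)%R].
Hypotheses (rho0 : 0 < rho) (x0 : 0 < x).
Hypothesis p0 : forall y, 0 < y -> 0 <= p y.
Hypothesis p1 : (\int[mu]_(y in pos) (p y)%:E = 1)%E.
Hypothesis mean_fin : (mean_jump p < +oo)%E.
Hypothesis models : forall lam : R, 0 < lam ->
  compound_poisson_model (P lam) lam p (E lam) (Y lam).
Local Notation m := (fine (mean_jump p)).

Let m0 : 0 < m.
Proof.
by apply: fine_gt0; rewrite mean_fin andbT; exact: (mean_jump_gt0 p0 p1 (models _ ltr01)).
Qed.

(** Intensity 1 is an arbitrary reference: the probability space changes with [lam] but the law of a
    jump does not, so constants built from [ell] serve every [lam]. *)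
Let ell : R := fine (laplace_jump (P 1) (Y 1)).

Let laplace_const lam : 0 < lam -> fine (laplace_jump (P lam) (Y lam)) = ell.
Proof.
move=> l0; have [g [mg g0 gp g1 _]] := density_minorant p0 p1.
by rewrite /ell /laplace_jump (laplace_jump_density (models _ l0) 0 mg g0 gp g1)
  (laplace_jump_density (models _ ltr01) 0 mg g0 gp g1).
Qed.

Let ell_bounds : 0 <= ell < 1.
Proof.
have l1 := laplace_jump_lt1 (models _ ltr01).
have l0 : (0 <= laplace_jump (P 1) (Y 1))%E.
  by apply: integral_ge0 => w _; rewrite lee_fin expR_ge0.
rewrite fine_ge0//= -lte_fin fineK//.
by rewrite ge0_fin_numE// (lt_trans l1)// ltry.
Qed.

Lemma near_lower (delta T C : R) : 0 <= delta -> 0 < T -> 0 < C ->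
  (forall (N : nat) (h := T / N.+2%:R),
    C - h <= h * \sum_(j < N.+1) expR (- (delta * h)) ^+ j.+1) ->
  forall eta, 0 < eta -> \forall lam \near +oo%R,
    ((lam * (m * C - eta))%:E <=
     value_function (P lam) x rho delta T%:E (E lam) (Y lam))%E.
Proof.
move=> d0 T0 C0 HC eta e0.
have mC0 : 0 < m * C by rewrite mulr_gt0.
have e4 : 0 < eta / 4 by rewrite divr_gt0.
(* The error [eta] is split into [eta / 4] for the mesh, [eta / 2] for the failure of the quick
   start, and [eta / 4] for terms of order [sqrt lam]. *)
pose N := Num.truncn (T * m / (eta / 4)); pose h := T / N.+2%:R.
have h0 : 0 < h by rewrite divr_gt0// ltr0n.
have mh : m * h <= eta / 4.
  rewrite /h mulrA ler_pdivrMr ?ltr0n// mulrC [leRHS]mulrC -ler_pdivrMr//.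
  apply: ltW; apply: lt_trans (truncnS_gt _) _.
  by rewrite ltr_nat.
(* Each of the two terms of [G] will be at most [th]. The minimum with [1 / 2] ensures [G <= 1]. *)
pose th := Num.min (1 / 2) (eta / 4 / (m * C)).
have th0 : 0 < th by rewrite lt_min !divr_gt0.
have th1 : th <= 1 / 2 by rewrite ge_min lexx.
have thC : m * C * th <= eta / 4.
  by rewrite mulrC -ler_pdivlMr// ge_min lexx orbT.
have /andP[ell0 ell1] := ell_bounds.
(* [k] is fixed before [lam]: enough jumps make a small total unlikely, and only afterwards must
   [lam] be large enough for that many to arrive by [eps]. *)
have [k Hk] : exists k : nat, expR (rho * T) * ell ^+ k.+1 <= th.
  have cv : ell ^+ n @[n --> \oo] --> (0 : R) by apply: cvg_expr; rewrite ger0_norm.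
  have thE : 0 < th / expR (rho * T) by rewrite divr_gt0// expR_gt0.
  move/cvgrPdist_le : cv => /(_ _ thE) [k _ Hk]; exists k.
  have := Hk k.+1 (leqnSn k); rewrite sub0r normrN ger0_norm ?exprn_ge0//.
  by rewrite ler_pdivlMr ?expR_gt0// mulrC.
pose eps := x / (2 * rho).
have eps0 : 0 < eps by rewrite divr_gt0// mulr_gt0.
have epsx : rho * eps < x.
  have -> : rho * eps = x / 2 by rewrite /eps; field; rewrite gt_eqF.
  by rewrite ltr_pdivrMr// ltr_pMr// ltr1n.
near=> lam.
have l1 : 1 < lam by near: lam; exact: nbhs_pinfty_gt.
have l0 : 0 < lam by rewrite (lt_trans _ l1).
(* The threshold comes from [expR (- y) <= 1 / y] at [y = lam / 2 * eps], which bounds the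
   late-arrival term of [G] by [th]. *)
have lG : 2 ^+ k.+2 / (eps * th) <= lam by near: lam; apply: nbhs_pinfty_ge; exact: num_real.
have K : (m * (1 + T + k%:R + 2) + rho * T) * Num.sqrt lam <= eta / 4 * lam.
  by near: lam; exact: near_sqrt_le.
have G1 : expR (- (lam / 2 * eps)) * 2 ^+ k.+1 <= th.
  rewrite expRN mulrC ler_pdivrMr ?expR_gt0//.
  apply: (@le_trans _ _ (th * (lam / 2 * eps))).
    have eth : 0 < eps * th by exact: mulr_gt0.
    move: lG; rewrite (ler_pdivrMr _ _ eth) (exprS _ k.+1).
    by move: (2 ^+ k.+1) => z; lra.
  rewrite ler_pM2l//; apply: le_trans (expR_ge1Dx _); lra.
set G := expR (- (lam / 2 * eps)) * 2 ^+ k.+1 + expR (rho * T) * ell ^+ k.+1.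
have Gth : G <= th + th by exact: lerD.
have G0 : 0 <= G by rewrite addr_ge0// mulr_ge0 ?expR_ge0// exprn_ge0.
have Gle1 : G <= 1 by apply: le_trans Gth _; lra.
have Gle1' : expR (- (lam / 2 * eps)) * 2 ^+ k.+1 +
    expR (rho * T) * fine (laplace_jump (P lam) (Y lam)) ^+ k.+1 <= 1.
  by rewrite laplace_const.
have key := @value_function_ge _ _ _ (P lam) lam p (E lam) (Y lam) l1 p0 p1 (models _ l0)
  mean_fin x rho delta T eps C N k (ltW rho0) T0 d0 (ltW eps0) epsx Gle1' (HC N).
apply: (le_trans _ key).
rewrite lee_fin laplace_const// -/G -/h.
have s1 : 1 <= Num.sqrt lam by rewrite -[leLHS]sqrtr1 ler_sqrt// ltW.
set q := Num.sqrt lam in K s1 *.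
have kap0 : 0 <= m * (k%:R + 2) + rho * T.
  by rewrite addr_ge0// mulr_ge0// ltW.
have kap : (m * (k%:R + 2) + rho * T) * 1 <= (m * (k%:R + 2) + rho * T) * q.
  exact: ler_wpM2l.
have GC : m * C * G <= eta / 2.
  apply: (@le_trans _ _ (m * C * (th + th))); first by rewrite ler_pM2l.
  move: thC; lra.
have mGh : 0 <= m * (G * h) by rewrite mulr_ge0 ?(ltW m0)// mulr_ge0// ltW.
have main : m * C - eta / 4 - eta / 2 <= m * ((1 - G) * (C - h)).
  have -> : m * ((1 - G) * (C - h)) = m * C - m * h - m * C * G + m * (G * h) by ring.
  lra.
have : lam * (m * C - eta / 4 - eta / 2) <= lam * (m * ((1 - G) * (C - h))).
  by rewrite ler_pM2l.
move: K kap; lra.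
Unshelve. all: by end_near. Qed.

End asymptotics.

Theorem theorem2p7 (R : realType) (rho x : R) (p : R -> R)
  (d : R -> measure_display) (Omega : forall lam : R, measurableType (d lam))
  (P : forall lam : R, probability (Omega lam) R)
  (E Y : forall lam : R, nat -> Omega lam -> R) :
  0 < rho -> 0 < x ->
  (forall y, 0 < y -> 0 <= p y) ->
  (\int[lebesgue_measure]_(y in [set y : R | (0 < y)%R]) (p y)%:E = 1)%E ->
  (\int[lebesgue_measure]_(y in [set y : R | (0 < y)%R]) (y * p y)%:E < +oo)%E ->
  (forall lam : R, 0 < lam -> compound_poisson_model (P lam) lam p (E lam) (Y lam)) ->
  let EY1 := fine (\int[lebesgue_measure]_(y in [set y : R | (0 < y)%R]) (y * p y)%:E)%E in
  [/\ (* (i) infinite horizon, delta > 0 *)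
      forall delta : R, 0 < delta ->
        (value_function (P lam) x rho delta +oo (E lam) (Y lam)
           * ((lam * EY1 / delta)^-1)%:E)%E @[lam --> +oo] --> 1%E,
      (* (ii) finite horizon T, delta > 0 *)
      forall delta T : R, 0 < delta -> 0 < T ->
        (value_function (P lam) x rho delta T%:E (E lam) (Y lam)
           * ((lam * EY1 / delta * (1 - expR (- (delta * T))))^-1)%:E)%E
          @[lam --> +oo] --> 1%E &
      (* (iii) finite horizon T, delta = 0 *)
      forall T : R, 0 < T ->
        (value_function (P lam) x rho 0 T%:E (E lam) (Y lam)
           * ((lam * EY1 * T)^-1)%:E)%E @[lam --> +oo] --> 1%E].
Proof.
move=> rho0 x0 p0 p1 mean_fin models EY1.
have m0 : 0 < EY1.
  by apply: fine_gt0; rewrite mean_fin andbT; exact: (mean_jump_gt0 p0 p1 (models _ ltr01)).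
have discount_gt0 (delta T : R) : 0 < delta -> 0 < T -> 0 < (1 - expR (- (delta * T))) / delta.
  by move=> d0 T0; rewrite divr_gt0// subr_gt0 -expR0 ltr_expR oppr_lt0 mulr_gt0.
split.
- move=> delta d0.
  apply: (@cvg_ratio1 _ _ _ (EY1 * (1 / delta))).
  + by move=> lam; field; rewrite gt_eqF.
  + by rewrite mulr_gt0// divr_gt0.
  + apply: (@near_upper _ _ x); [exact: ltW|exact: ltW|move=> lam l0].
    exact: (value_function_le_infty l0 p0 p1 (models _ l0) mean_fin (ltW x0) (ltW rho0) d0).
  move=> eta e0.
  (* Truncating at [T] loses [EY1 * expR (- (delta * T)) / delta]. With this [T] the loss equals
     [eta / 2] times [y * expR (- y)] for [y = delta * T], and [y * expR (- y) <= 1]. *)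
  pose T := 2 * EY1 / (delta ^+ 2 * eta).
  have d2 : 0 < delta ^+ 2 by rewrite exprn_gt0.
  have T0 : 0 < T by rewrite /T divr_gt0// mulr_gt0.
  have e2 : 0 < eta / 2 by rewrite divr_gt0.
  have := @near_lower R rho x p d Omega P E Y rho0 x0 p0 p1 mean_fin models delta T _
    (ltW d0) T0 (discount_gt0 _ _ d0 T0) (fun N => discount_sum_ge N d0 T0) _ e2.
  apply: filterS2 (nbhs_pinfty_gt (num_real 0)) => lam l0 lo.
  apply: (le_trans _ (value_function_le_horizon _ _ _ _ T _ _)).
  apply: (le_trans _ lo); rewrite lee_fin ler_pM2l// -/EY1.
  have : EY1 * (expR (- (delta * T)) / delta) <= eta / 2.
    have -> : EY1 * (expR (- (delta * T)) / delta) =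
        eta / 2 * (expR (- (delta * T)) * (delta * T)).
      by rewrite {3}/T; field; rewrite !gt_eqF.
    rewrite ler_piMr ?(ltW e2)// expRN mulrC ler_pdivrMr ?expR_gt0// mul1r.
    by apply: le_trans (expR_ge1Dx _); rewrite lerDr.
  lra.
- move=> delta T d0 T0.
  have C0 := discount_gt0 _ _ d0 T0.
  apply: (@cvg_ratio1 _ _ _ (EY1 * ((1 - expR (- (delta * T))) / delta))).
  + by move=> lam; field; rewrite gt_eqF.
  + by rewrite mulr_gt0.
  + apply: (@near_upper _ _ x); [exact: ltW|exact: ltW|move=> lam l0].
    exact: (value_function_le_finite l0 p0 p1 (models _ l0) mean_fin (ltW x0) (ltW rho0) d0 T0).
  exact: (@near_lower R rho x p d Omega P E Y rho0 x0 p0 p1 mean_fin models delta T _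
    (ltW d0) T0 C0 (fun N => discount_sum_ge N d0 T0)).
- move=> T T0.
  apply: (@cvg_ratio1 _ _ _ (EY1 * T)).
  + by move=> lam; rewrite mulrA.
  + by rewrite mulr_gt0.
  + apply: (@near_upper _ _ x); [exact: ltW|exact: ltW|move=> lam l0].
    exact: (value_function_le_undiscounted l0 p0 p1 (models _ l0) mean_fin (ltW x0) (ltW rho0) T0).
  (* All discount factors are 1 and the [N + 1] payment cells have total length [T - h], so the
     Riemann bound holds with equality for [C = T]. *)
  apply: (@near_lower R rho x p d Omega P E Y rho0 x0 p0 p1 mean_fin models 0 T T
    (lexx 0) T0 T0) => N /=; set h := T / N.+2%:R.
  rewrite (eq_bigr (fun=> 1)); last by move=> j _; rewrite mul0r oppr0 expR0 expr1n.
  rewrite sumr_const card_ord lerBlDr -[leRHS](_ : h * N.+2%:R = _).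
    by rewrite /h divfK// pnatr_eq0.
  by rewrite -natr1; ring.
Qed.
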